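(* Let $T$ be a locally finite semi-homogeneous tree in which each vertex has valency at least three. Suppose that $G$ is a closed subgroup of the automorphism group $\operatorname{Aut}(T)$ of $T$ that acts $2$-transitively on the set of ends $\partial T$. Then every $s$-multiplicative semigroup in $G$ is contained in one of the following types of semigroup, each of which is a maximal $s$-multiplicative semigroup in $G$: (1) the fixator in $G$ of the midpoint of an edge that is inverted by (some element of) $G$; (2) the fixator $G_v$ in $G$ of a vertex $v$; (3) a set $G_{(v,I)}$, with $v$ a vertex of $T$ and $I\subset E(v)$ proper and non-empty; (4) a set $G_{\omega+}$ or $G_{\omega-}$, with $\omega\in\partial T$ an end of $T$.
   Context: $\operatorname{Aut}(T)$ carries the topology of pointwise convergence on vertices, so that $G$ is a totally disconnected, locally compact group. The scale function of a totally disconnected, locally compact group $G$ is $s(x)=\min\{[xVx^{-1}:xVx^{-1}\cap V] : V\leqslant G \text{ compact and open}\}$. A semigroup $\mathcal S\subseteq G$ is $s$-multiplicative if $s(xy)=s(x)s(y)$ for all $x,y\in\mathcal S$; it is a maximal $s$-multiplicative semigroup if it is maximal under inclusion among the $s$-multiplicative semigroups in $G$. A tree is semi-homogeneous if the valency of a vertex depends only on its class in the standard bipartition of the vertex set. An end is an equivalence class of rays (semi-infinite geodesics), two rays being equivalent if their intersection is a ray. An automorphism of $T$ is elliptic if it fixes a vertex or inverts an edge (inversions count as elliptic); otherwise it is hyperbolic, i.e. it induces a nontrivial translation along a unique bi-infinite geodesic, its axis. For $g$ hyperbolic, the attracting end $\epsilon_+(g)$ is the end of the axis towards which $g$ translates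 and the repelling end $\epsilon_-(g)$ is the other end of the axis. For an automorphism $g$, $\ell(g)$ is the minimum distance by which $g$ moves points of (the geometric realization of) $T$ and $\min(g)=\{p\in T : d(p,g.p)=\ell(g)\}$; so $\min(g)$ is the fixed point set if $g$ is elliptic and the axis if $g$ is hyperbolic. Oriented edges are ordered pairs $e=(o(e),t(e))$ of adjacent vertices, and $\bar e=(t(e),o(e))$. A hyperbolic $h$ translates along an oriented edge $e$ if $e$ lies on the axis of $h$ and is directed towards $\epsilon_+(h)$. For a vertex $v$, $E(v)=\{e : t(e)=v\}$ is the set of oriented edges directed to $v$. For a proper non-empty subset $I\subset E(v)$, put $I^*=\{\bar e : e\in E(v)\setminus I\}$. A hyperbolic $g$ whose axis passes through $v$ is said to translate in through $I$ and out through $I^*$ if there are $e_1\in I$ and $e_2\in I^*$ on the axis of $g$ such that $g$ translates along $e_1$ and along $e_2$. Define $G_{(v,I)}$ to be the set of $g\in G$ with $v\in\min(g)$ such that $g.I=I$ if $g$ is elliptic, and $g$ translates in through $I$ and out through $I^*$ if $g$ is hyperbolic. For an end $\omega$, let $G_\omega$ be the stabilizer of $\omega$ in $G$ and put $G_{\omega+}=\{g\in G_\omega : g \text{ is elliptic, or } g \text{ is hyperbolic and } \omega=\epsilon_+(g)\}$ and $G_{\omega-}=\{g\in G_\omega : g \text{ is elliptic, or } g \text{ is hyperbolic and } \omega=\epsilon_-(g)\}$. *)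

(* Defs.v *)
From HB Require Import structures.
From mathcomp Require Import all_boot all_order all_algebra finmap.
From mathcomp Require Import all_classical all_reals topology.

Set Implicit Arguments.
Unset Strict Implicit.
Unset Printing Implicit Defensive.

Import Order.TTheory GRing.Theory Num.Theory.
Local Open Scope classical_set_scope.
Local Open Scope ring_scope.

(** * Trees *)

(* A cycle is a [ucycle] of length at least 3: a two-element [ucycle]
   is an edge traversed back and forth. *)
Record tree := Tree {
  vertex :> choiceType;
  adj : rel vertex;
  tree_inhabited : inhabited vertex;
  adj_sym : symmetric adj;
  adj_irr : irreflexive adj;
  tree_connected : forall u v, exists2 p, path adj u p & last u p = v;
  tree_acyclic : forall c, ucycle adj c -> (size c <= 2)%N
}.
Arguments adj {t}.

(* The least element of [A]; the value [0] for the empty set is a dummy. *)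
Definition nat_min (A : set nat) : nat :=
  xget 0%N [set n | A n /\ forall m, A m -> (n <= m)%N].

Section TreeDefs.
Variable T : tree.
Implicit Types (u v : T) (r : nat -> T) (c : int -> T).

Definition dist u v : nat :=
  nat_min [set n | exists p, [/\ path adj u p, last u p = v & size p = n]].

Definition nbrs v : set T := [set u | adj v u].

Definition locally_finite := forall v, finite_set (nbrs v).

Definition valency v : nat := #|` fset_set (nbrs v)|.

(* Two vertices are in the same class of the bipartition when their
   distance is even. *)
Definition semi_homogeneous :=
  forall u v, ~~ odd (dist u v) -> valency u = valency v.

Definition is_ray r := forall m n : nat, dist (r m) (r n) = `|m%:Z - n%:Z|%N.

Definition is_line c := forall m n : int, dist (c m) (c n) = `|m - n|%N.

Definition ray_equiv r r' :=
  exists2 r'', is_ray r'' & range r `&` range r' = range r''.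

Definition end_of r : set (nat -> T) := [set r' | is_ray r' /\ ray_equiv r r'].

Definition ends : set (set (nat -> T)) := [set end_of r | r in is_ray].

(* An oriented edge is a pair (origin, terminus). *)
Definition rev_edge (e : T * T) : T * T := (e.2, e.1).

Definition edges_to v : set (T * T) := [set e | adj e.1 e.2 /\ e.2 = v].

Definition edges_star v (I : set (T * T)) : set (T * T) :=
  [set rev_edge e | e in edges_to v `\` I].

End TreeDefs.
Arguments locally_finite : clear implicits.
Arguments semi_homogeneous : clear implicits.
Arguments ends : clear implicits.

(** * The automorphism group and its topology *)

Record aut (T : tree) := Aut {
  aut_fun :> T -> T;
  aut_inv : T -> T;
  autK : cancel aut_fun aut_inv;
  autVK : cancel aut_inv aut_fun;
  aut_adj : forall u v, adj (aut_fun u) (aut_fun v) = adj u v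
}.

Section AutGroup.
Variable T : tree.
Implicit Types g h : aut T.

Lemma aut_eq g h : (forall v, g v = h v) -> g = h.
Proof.
case: g h => [f f' fK f'K fa] [k k' kK k'K ka] /= /funext fk.
rewrite -{k}fk in kK k'K ka *.
have f'k' : f' = k' by apply/funext => v; rewrite -[in LHS](k'K v) fK.
rewrite -{k'}f'k' in kK k'K *.
by congr Aut; exact: Prop_irrelevance.
Qed.

Definition aut_one : aut T :=
  @Aut T id id (fun=> erefl) (fun=> erefl) (fun _ _ => erefl).

Lemma aut_inv_adj g u v : adj (aut_inv g u) (aut_inv g v) = adj u v.
Proof. by rewrite -(aut_adj g) !autVK. Qed.

Definition aut_invg g : aut T :=
  Aut (@autVK T g) (@autK T g) (aut_inv_adj g).

Lemma aut_mul_adj g h u v : adj ((g \o h) u) ((g \o h) v) = adj u v.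
Proof. by rewrite /= !aut_adj. Qed.

Definition aut_mul g h : aut T :=
  Aut (can_comp (@autK T g) (@autK T h))
      (can_comp (@autVK T h) (@autVK T g)) (aut_mul_adj g h).

Lemma aut_mulA : associative aut_mul.
Proof. by move=> f g h; exact: aut_eq. Qed.

Lemma aut_mul1g : left_id aut_one aut_mul.
Proof. by move=> g; exact: aut_eq. Qed.

Lemma aut_mulg1 : right_id aut_one aut_mul.
Proof. by move=> g; exact: aut_eq. Qed.

Lemma aut_mulVg : left_inverse aut_one aut_invg aut_mul.
Proof. by move=> g; apply: aut_eq => v /=; rewrite autK. Qed.

Lemma aut_mulgV : right_inverse aut_one aut_invg aut_mul.
Proof. by move=> g; apply: aut_eq => v /=; rewrite autVK. Qed.

HB.instance Definition _ := gen_eqMixin (aut T).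
HB.instance Definition _ := gen_choiceMixin (aut T).
HB.instance Definition _ := isGroup.Build (aut T)
  aut_mulA aut_mul1g aut_mulg1 aut_mulVg aut_mulgV.

Definition aut_ptws g : {ptws T -> discrete_topology T} := aut_fun g.

HB.instance Definition _ := Topological.copy (aut T) (initial_topology aut_ptws).

End AutGroup.

(** * Scale function and scale-multiplicative semigroups *)

Section Scale.
Variable T : tree.
Implicit Types (G H K V S : set (aut T)) (x y : aut T).

Definition is_subgroup H :=
  [/\ H 1%g, (forall x y, H x -> H y -> H (x * y)%g) &
      forall x, H x -> H (x^-1)%g].

(* Openness is relative to the subspace topology of [G]. *)
Definition compact_open_subgroup G V :=
  [/\ is_subgroup V, compact V & exists2 O, open O & V = G `&` O].

Definition conj_set x V : set (aut T) := [set (x * y * x^-1)%g | y in V].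

Definition has_index H K (n : nat) :=
  ([set [set (x * y)%g | y in K] | x in H] #= `I_n)%card.

Definition scale G x : nat :=
  nat_min [set n | exists2 V, compact_open_subgroup G V &
    has_index (conj_set x V) (conj_set x V `&` V) n].

Definition s_multiplicative G S :=
  [/\ S `<=` G, (forall x y, S x -> S y -> S (x * y)%g) &
      forall x y, S x -> S y -> scale G (x * y)%g = (scale G x * scale G y)%N].

Definition maximal_s_multiplicative G S :=
  s_multiplicative G S /\
  forall S', s_multiplicative G S' -> S `<=` S' -> S' = S.

End Scale.

(** * The action on ends, and hyperbolic and elliptic automorphisms *)

Section Automorphisms.
Variable T : tree.
Implicit Types (G : set (aut T)) (g : aut T) (u v : T) (omega : set (nat -> T)).

Definition end_act g omega : set (nat -> T) := [set g \o r | r in omega].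

Definition two_transitive_on_ends G :=
  forall omega1 omega2 omega1' omega2',
    ends T omega1 -> ends T omega2 -> ends T omega1' -> ends T omega2' ->
    omega1 <> omega2 -> omega1' <> omega2' ->
    exists g, [/\ G g, end_act g omega1 = omega1' & end_act g omega2 = omega2'].

Definition inverts g u v := [/\ adj u v, g u = v & g v = u].

Definition elliptic g := (exists v, g v = v) \/ (exists u v, inverts g u v).

Definition hyperbolic g := ~ elliptic g.

(* The axis is parametrized so that [g] translates in the positive direction. *)
Definition is_axis g (c : int -> T) :=
  is_line c /\ exists2 k : nat, (0 < k)%N & forall n, g (c n) = c (n + k%:Z).

Definition attracting_end g omega :=
  exists2 c, is_axis g c & omega = end_of (fun n : nat => c n%:Z).

Definition repelling_end g omega :=
  exists2 c, is_axis g c & omega = end_of (fun n : nat => c (- n%:Z)).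

Definition translates_along g (e : T * T) :=
  exists2 c, is_axis g c & exists n, e = (c n, c (n + 1)).

Definition translates_in_out g v (I : set (T * T)) :=
  (exists2 e, I e & translates_along g e) /\
  (exists2 e, edges_star v I e & translates_along g e).

Definition fix_end G omega : set (aut T) :=
  [set g | G g /\ end_act g omega = omega].

Definition fix_end_plus G omega : set (aut T) :=
  [set g | fix_end G omega g /\
    (elliptic g \/ (hyperbolic g /\ attracting_end g omega))].

Definition fix_end_minus G omega : set (aut T) :=
  [set g | fix_end G omega g /\
    (elliptic g \/ (hyperbolic g /\ repelling_end g omega))].

Definition fix_vertex G v : set (aut T) := [set g | G g /\ g v = v].

End Automorphisms.

(** * The geometric realization *)

Section Realization.
Variables (R : realType) (T : tree).
Implicit Types (G : set (aut T)) (g : aut T) (u v : T) (p q : T -> R).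

(* Points are given by their barycentric coordinates: [bary u v t] is the
   point at distance [t] from [u] on the edge from [u] to [v], and the vertex
   [v] is [bary v v 0]. *)
Definition bary u v (t : R) : T -> R :=
  fun w => (1 - t) * (w == u)%:R + t * (w == v)%:R.

Definition realization : set (T -> R) :=
  [set p | exists u v t, [/\ u = v \/ adj u v, 0 <= t <= 1 & p = bary u v t]].

Definition vertex_point v : T -> R := bary v v 0.

Definition midpoint u v : T -> R := bary u v 2^-1.

Definition point_act g p : T -> R := p \o (g^-1)%g.

Definition carried_by p u v := [set w | p w != 0] `<=` [set u; v].

(* The path metric: a shortest path from [p] to [q] either stays within one
   edge or runs from [p] to a vertex [u] of the cell containing it, on to a
   vertex [v] of the cell containing [q], and then to [q]. *)
Definition point_dist p q : R := inf
  ([set d | exists u v, [/\ adj u v, carried_by p u v, carried_by q u v &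
                            d = `|p u - q u|]] `|`
   [set d | exists u v, [/\ 0 < p u, 0 < q v &
                            d = (1 - p u) + (dist u v)%:R + (1 - q v)]]).

Definition translation_length g : R :=
  inf [set point_dist p (point_act g p) | p in realization].

Definition min_set g : set (T -> R) :=
  [set p | realization p /\ point_dist p (point_act g p) = translation_length g].

Definition fix_midpoint G u v : set (aut T) :=
  [set g | G g /\ point_act g (midpoint u v) = midpoint u v].

Definition vertex_semigroup G v (I : set (T * T)) : set (aut T) :=
  [set g | [/\ G g, min_set g (vertex_point v),
    (elliptic g -> [set (g e.1, g e.2) | e in I] = I) &
    (hyperbolic g -> translates_in_out g v I)]].

Variant standard_semigroup G : set (aut T) -> Prop :=
| StdMidpoint u v g of G g & inverts g u v :
    standard_semigroup G (fix_midpoint G u v)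
| StdVertex v :
    standard_semigroup G (fix_vertex G v)
| StdVertexEdges v (I : set (T * T)) of I `<` edges_to v & I !=set0 :
    standard_semigroup G (vertex_semigroup G v I)
| StdEndPlus omega of ends T omega :
    standard_semigroup G (fix_end_plus G omega)
| StdEndMinus omega of ends T omega :
    standard_semigroup G (fix_end_minus G omega).

End Realization.

(* Main.v *)
Require Import Defs.
From mathcomp Require Import all_boot all_order all_algebra finmap zify lra.
From mathcomp Require Import all_classical all_reals topology.

(** The square of the scale of [g] is [N ^ l], where [l] is the translation length of
[g] and [N] is the product of the branching numbers at the two ends of any edge
([scale_sq]). That it is no larger is seen on the fixator of an edge of the axis.
That it is no smaller is a growth argument: if a compact open subgroup [V] gives
index [m], then [V] moves [g^-n v] to at most constantly many times [m ^ n]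
vertices; but for [v] on the axis the stabilizer of [v] is covered by finitely
many cosets of [V] and is transitive on spheres, whose sizes grow at the rate
claimed. Hence a semigroup is multiplicative for the scale exactly when
translation lengths add up on it ([s_multiplicativeP]), and the rest is geometry
of the tree.

Transitivity on spheres holds because any two lines through a vertex are
equivalent under its stabilizer ([line_transitive]): an element of [G] carrying a
line to one sharing half of it translates along the common half by some amount,
every line is translated by that amount, and so the shift can be undone.

Translation lengths are handled through the axial vertices of [g], those [x] with
[d x (g (g x)) = 2 * d x (g x)]: the fixed vertices of an elliptic element, the
axis of a hyperbolic one, and none for an inversion. If lengths add up for [g] and
[h], their sets of axial vertices meet ([axial_meet]), and an inversion in the
semigroup forces every element to preserve the inverted edge
([inversion_preserves_edge]). By a Helly argument ([axial_helly]) a semigroup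
with additive lengths and without inversions therefore either has a common axial
vertex [v], or there is a ray with a tail of axial vertices for each element. In
the first case, unless the semigroup fixes [v], the directions at [v] towards the
[g^-1 v] and those towards the [g v] are disjoint sets, which gives [I]; in the
second all elements shift the ray in the same direction.

For maximality, let [g] belong to a larger semigroup with additive lengths but not
to the standard one. An inverted edge is preserved by [g] by the above. For the
stabilizer of [v], transitivity on spheres gives two elements whose products with
[g] have different lengths. For the semigroups with hyperbolic elements a
translation, from [even_translation], undoes part of the displacement by [g] and
so has a product with [g] that is too short. *)

Set Implicit Arguments.
Unset Strict Implicit.
Unset Printing Implicit Defensive.

Import Order.TTheory GRing.Theory Num.Theory.
Local Open Scope classical_set_scope.
Local Open Scope nat_scope.

(** * The metric of a tree *)

Lemma nat_minP (A : set nat) : A !=set0 ->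
  A (nat_min A) /\ forall m, A m -> nat_min A <= m.
Proof.
move=> [a Aa]; rewrite /nat_min.
have ex : exists n, `[< A n >] by exists a; apply/asboolP.
case: (ex_minnP ex) => n /asboolP An nmin.
have H : [set n | A n /\ forall m, A m -> n <= m] n.
  by split=> // m Am; apply: nmin; apply/asboolP.
exact: (@xgetPex _ 0 [set n | A n /\ forall m, A m -> n <= m] (ex_intro _ n H)).
Qed.

Lemma last_rev_belast (X : Type) (a : X) p : last (last a p) (rev (belast a p)) = a.
Proof. by case: p => [|c p] //=; rewrite rev_cons last_rcons. Qed.

Section Metric.
Variable T : tree.
Implicit Types (u v x y z w : T) (g h : aut T).

Local Notation d := (@dist T).

Lemma dist_path x y : exists2 p, path adj x p /\ last x p = y & size p = d x y.
Proof.
rewrite /dist; set A := [set n | _].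
have /nat_minP[[p [? ? <-]] _] : A !=set0.
  by have [p pp pl] := tree_connected x y; exists (size p), p.
by exists p.
Qed.

Lemma dist_le x y p : path adj x p -> last x p = y -> d x y <= size p.
Proof.
move=> pp pl; rewrite /dist; set A := [set n | _].
by have /nat_minP[_] : A !=set0; [exists (size p), p | apply; exists p].
Qed.

Lemma distxx x : d x x = 0.
Proof. by apply/eqP; rewrite -leqn0 (@dist_le x x [::]). Qed.

Lemma dist_eq0 x y : d x y = 0 -> x = y.
Proof. by have [p [_ <-] <-] := dist_path x y; case: p. Qed.

Lemma dist_triangle x y z : d x z <= d x y + d y z.
Proof.
have [p [pp pl] <-] := dist_path x y; have [q [qp ql] <-] := dist_path y z.
by rewrite -size_cat dist_le ?cat_path ?last_cat ?pl ?pp.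
Qed.

Lemma dist_sym x y : d x y = d y x.
Proof.
suff H a b : d b a <= d a b by apply/eqP; rewrite eqn_leq !H.
have [p [pp pl] <-] := dist_path a b.
rewrite -(size_belast a p) -size_rev; apply: dist_le.
  by rewrite -pl rev_path (eq_path (e' := adj)) // => x' y'; rewrite adj_sym.
by rewrite -pl last_rev_belast.
Qed.

Lemma dist_adj x y : adj x y -> d x y = 1.
Proof.
move=> xy; apply/eqP; rewrite eqn_leq (@dist_le x y [:: y]) /= ?xy //.
by rewrite lt0n; apply/eqP => /dist_eq0 e; move: xy; rewrite e adj_irr.
Qed.

Lemma dist1_adj x y : d x y = 1 -> adj x y.
Proof.
have [p [pp pl] ps] := dist_path x y; rewrite -ps.
by case: p pp pl {ps} => [|z [|? ?]] //= /andP[xz _] <-.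
Qed.

Lemma dist_aut g x y : d (g x) (g y) = d x y.
Proof.
suff H (f : aut T) a b : d (f a) (f b) <= d a b.
  apply/eqP; rewrite eqn_leq H /=.
  by have := H (aut_invg g) (g x) (g y); rewrite /= !autK.
have [p [pp pl] <-] := dist_path a b.
rewrite -(size_map f); apply: dist_le; last by rewrite last_map pl.
by rewrite path_map (eq_path (e' := adj)) // => a' b' /=; rewrite aut_adj.
Qed.

(** A vertex of a geodesic from [x], other than its endpoint, is nearer to
[x] than the endpoint. *)
Lemma geodesic_avoids x y v p : path adj x p -> last x p = y ->
  size p = d x y -> d x y <= d x v -> v <> y -> v \notin x :: p.
Proof.
move=> pp pl ps le vy; apply/negP => vp.
have : d x v < size p; last by lia.
move: vp; rewrite inE => /predU1P[e|vp].
  by subst v; move: le; rewrite distxx leqn0 => /eqP /dist_eq0.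
move: pp pl ps; case/splitPr: vp => p1 p2.
rewrite cat_path last_cat /= => /and3P[p1p vl p2p] pl ps.
have := @dist_le x v (rcons p1 v); rewrite rcons_path p1p vl last_rcons.
move=> /(_ erefl erefl); rewrite size_rcons size_cat /=.
by case: p2 p2p pl ps => [//=|c p2] /= *; lia.
Qed.

(** Two neighbours of [v] that are not farther from [x] than [v] would be
joined outside [v], closing up a cycle through [v]. *)
Lemma closer_neighbour_unique x v u1 u2 : adj v u1 -> adj v u2 ->
  d x u1 <= d x v -> d x u2 <= d x v -> u1 = u2.
Proof.
move=> v1 v2 le1 le2; apply/eqP/negPn/negP => u12.
have [p1 [p1p p1l] p1s] := dist_path x u1.
have [p2 [p2p p2l] p2s] := dist_path x u2.
have nv u : adj v u -> v <> u by move=> /[swap] <-; rewrite adj_irr.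
have a1 := geodesic_avoids p1p p1l p1s le1 (nv _ v1).
have a2 := geodesic_avoids p2p p2l p2s le2 (nv _ v2).
have [q qp [ql qv]] : exists2 q, path adj u1 q & last u1 q = u2 /\ v \notin u1 :: q.
  exists (rev (belast x p1) ++ p2).
    rewrite cat_path -{1}p1l rev_path.
    rewrite (eq_path (e' := adj)) => [|? ?]; last by rewrite adj_sym.
    rewrite p1p /=.
    suff -> : last u1 (rev (belast x p1)) = x by [].
    by rewrite -p1l last_rev_belast.
  rewrite last_cat; split.
    suff -> : last u1 (rev (belast x p1)) = x by [].
    by rewrite -p1l last_rev_belast.
  rewrite inE mem_cat mem_rev !negb_or.
  move: a1; rewrite lastI mem_rcons inE negb_or p1l => /andP[-> ->] /=.
  by move: a2; rewrite inE negb_or => /andP[].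
case: (shortenP qp) ql => q' q'p q'u sub ql.
have /tree_acyclic : ucycle adj [:: v, u1 & q'].
  rewrite /ucycle /= rcons_path v1 q'p ql adj_sym v2 /=.
  have -> : v \notin u1 :: q'.
    move: qv; rewrite !inE !negb_or => /andP[-> /=]; apply: contra.
    by apply: sub.
  exact: q'u.
by case: q' {q'p q'u sub} ql => [e|//]; move: u12; rewrite -e /= eqxx.
Qed.

(** Were the distances equal, [u] and the last vertex before [v] on a geodesic
from [x] would be two such neighbours. *)
Lemma dist_adj_cases x v u : adj v u -> d x u = (d x v).+1 \/ d x v = (d x u).+1.
Proof.
move=> vu; have vu1 := dist_adj vu.
have t1 := dist_triangle x v u; have t2 := dist_triangle x u v.
have t3 := dist_sym u v.
have : d x u <> d x v; last by lia.
move=> e; have [E|xv] := eqVneq x v; first by subst x; rewrite distxx in e; lia.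
have [p [pp pl] ps] := dist_path x v.
elim/last_ind: p pp pl ps => [_ /= /eqP|p w _]; first by rewrite (negbTE xv).
rewrite rcons_path last_rcons size_rcons => /andP[pp lw] wv ps; subst w.
have := dist_le pp erefl; set w := last x p in lw * => dw.
have wu : w = u by apply: (@closer_neighbour_unique x v); [rewrite adj_sym | | lia | lia].
by subst w; rewrite wu in dw; lia.
Qed.

Lemma dist_step x y n : d x y = n.+1 -> exists2 z, adj x z & d z y = n.
Proof.
have [p [pp pl] ps] := dist_path x y; rewrite -ps.
case: p pp pl ps => //= z p /andP[xz pp] pl ps [e].
exists z => //; have := dist_le pp pl; have := dist_triangle x z y.
by rewrite (dist_adj xz) -e; lia.
Qed.

(** Continuing without backtracking only increases the distance from [y], since
the one nearer neighbour is the vertex just left. *)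
Lemma geodesic_concat y z a b : adj a b -> d y b = (d y a).+1 ->
  d a z = (d b z).+1 -> d y z = d y a + d a z.
Proof.
move en : (d b z) => n; elim: n a b en => [|n IH] a b en ab yb az.
  by rewrite az -(dist_eq0 en) yb addn1.
have [c bc cz] := dist_step en.
have yc : d y c = (d y b).+1.
  case: (dist_adj_cases y bc) => // e.
  have ca : c = a.
    by apply: (@closer_neighbour_unique y b); [ | rewrite adj_sym | lia | lia].
  by subst c; lia.
by rewrite (IH b c) //; lia.
Qed.

(** Move from [x] towards [y] as long as this also approaches [z]. *)
Lemma median_ex x y z : exists m,
  [/\ d x y = d x m + d m y, d x z = d x m + d m z & d y z = d y m + d m z].
Proof.
move en : (d x y) => n; elim: n x en => [|n IH] x en.
  by exists x; rewrite (dist_eq0 en) !distxx.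
have [e|ne] := eqVneq (d y z) (d y x + d x z); first by exists x; rewrite distxx en.
have [x1 xx1 x1y] := dist_step en.
have zx : d z x = (d z x1).+1.
  case: (dist_adj_cases z xx1) => // e; move/eqP: ne; case.
  rewrite dist_sym (geodesic_concat xx1 e); last by rewrite en x1y.
  by rewrite (dist_sym z x) (dist_sym x y); lia.
have [m [m1 m2 m3]] := IH _ x1y; exists m.
have := dist_triangle x x1 m; have := dist_triangle x m y.
have := dist_triangle x m z; have := dist_adj xx1.
have := dist_sym z x; have := dist_sym z x1.
by split; lia.
Qed.

Lemma between_ex x y n : n <= d x y -> exists z, d x z = n /\ d x y = n + d z y.
Proof.
elim: n => [_|n IH lt]; first by exists x; rewrite distxx.
have [z [xz zy]] := IH (ltnW lt).
have [k ek] : exists k, d z y = k.+1 by exists (d z y).-1; lia.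
have [w zw wy] := dist_step ek; exists w.
have := dist_triangle x z w; have := dist_triangle x w y.
by rewrite (dist_adj zw); lia.
Qed.

Lemma between_unique x y z z' : d x y = d x z + d z y ->
  d x y = d x z' + d z' y -> d x z = d x z' -> z = z'.
Proof.
move en : (d z y) => n; elim: n z z' en => [|n IH] z z' en h h' e.
  by rewrite (dist_eq0 en) (@dist_eq0 z' y) //; lia.
have [k ek] : exists k, d z' y = k.+1 by exists (d z' y).-1; lia.
have [w zw wy] := dist_step en; have [w' zw' wy'] := dist_step ek.
have := dist_triangle x z w; have := dist_triangle x w y.
have := dist_triangle x z' w'; have := dist_triangle x w' y.
rewrite (dist_adj zw) (dist_adj zw') => t1 t2 t3 t4.
have ww : w = w' by apply: IH; lia.
subst w'; by apply: (@closer_neighbour_unique x w); [rewrite adj_sym | rewrite adj_sym | lia | lia].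
Qed.

(** Trees are 0-hyperbolic: the projections of [x] and of [y] to the geodesic
from [z] to [w] lie on it in some order. Together with the triangle inequality
and the parity of perimeters this carries all the geometry below. *)
Lemma four_point x y z w : d x y + d z w <= maxn (d x z + d y w) (d x w + d y z).
Proof.
have [m1 [a1 a2 a3]] := median_ex z x w.
have [m2 [b1 b2 b3]] := median_ex z y w.
have T1 := dist_triangle x m1 y; have T2 := dist_triangle x m2 y.
have S1 := dist_sym z x; have S2 := dist_sym z y; have S3 := dist_sym x m1.
have S4 := dist_sym y m1; have S5 := dist_sym y m2; have S6 := dist_sym x m2.
have [le|/ltnW le] := leqP (d z m1) (d z m2).
  have [m [m1' m2']] := between_ex le.
  have t := dist_triangle m m2 w; have t' := dist_triangle z m w.
  have em : m = m1 by apply: (@between_unique z w); lia.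
  by have t'' := dist_triangle m m2 y; subst m; lia.
have [m [m1' m2']] := between_ex le.
have t := dist_triangle m m1 w; have t' := dist_triangle z m w.
have em : m = m2 by apply: (@between_unique z w); lia.
by have t'' := dist_triangle m m1 x; subst m; lia.
Qed.

Lemma odd_perimeter x y z : odd (d x y + d y z + d x z) = false.
Proof.
have [m [-> -> ->]] := median_ex x y z; rewrite (dist_sym y m); lia.
Qed.

End Metric.

(* Linear arithmetic has to be told which distances agree by symmetry, and needs
the four-point condition with each of the three pairings on the left. *)
Ltac dist_syms := repeat match goal with
  | _ : context [@dist ?T ?a ?b] |- _ => lazymatch goal with
     | _ : @dist T a b = @dist T b a |- _ => fail
     | _ : @dist T b a = @dist T a b |- _ => fail
     | _ => have := @dist_sym T a b; move=> ? end
  | |- context [@dist ?T ?a ?b] => lazymatch goal with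
     | _ : @dist T a b = @dist T b a |- _ => fail
     | _ : @dist T b a = @dist T a b |- _ => fail
     | _ => have := @dist_sym T a b; move=> ? end
  end.
Ltac fp x y z w :=
  have := four_point x y z w; have := four_point x z y w;
  have := four_point x w y z; move=> ? ? ?.
Ltac dlia := dist_syms; lia.

(** * Translation lengths *)

Section Translation.
Variable T : tree.
Implicit Types (u v x y z w : T) (g h : aut T).

Local Notation d := (@dist T).

Lemma autVKg g x : g ((g^-1)%g x) = x.
Proof. exact: autVK. Qed.

Lemma autKg g x : (g^-1)%g (g x) = x.
Proof. exact: autK. Qed.

Lemma aut_inj g : injective g.
Proof. exact: can_inj (autK g). Qed.

Lemma dist_autV g x y : d ((g^-1)%g x) y = d x (g y).
Proof. by rewrite -(dist_aut g) autVKg. Qed.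

Lemma geodesic_overlap x y z w : d x z = d x y + d y z ->
  d y w = d y z + d z w -> y <> z -> d x w = d x y + d y z + d z w.
Proof.
move=> h1 h2 yz.
have : d y z <> 0 by move/dist_eq0.
fp x y z w; have := dist_triangle x z w; dlia.
Qed.

(** The vertices realizing the translation length, described without it: those
at which [g] and [g^2] do not backtrack. An inversion has none. *)
Definition axial g x := d x (g (g x)) = 2 * d x (g x).

(** The geodesic from [v] to [g v] and its image overlap in a segment ending at
[g v]. If this is shorter than half, removing it at both ends leaves a segment
on which [g] translates; otherwise [g] fixes the middle of the geodesic. *)
Lemma translation_trichotomy g v :
  [\/ exists2 x, g x = x & d v (g v) = 2 * d v x,
      exists x y, [/\ inverts g x y, d v (g v) = (2 * d v x).+1 &
                      d v y = (d v x).+1] |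
      exists x, [/\ axial g x, 0 < d x (g x),
                    d v (g v) = 2 * d v x + d x (g x) &
                    d v (g (g v)) = 2 * d v x + 2 * d x (g x)]].
Proof.
have par := odd_perimeter v (g v) (g (g v)).
have A a b : d (g a) (g b) = d a b := dist_aut g a b.
have vv := A v (g v).
have tri := dist_triangle v (g v) (g (g v)).
set k := d v (g v) in par vv tri *.
have [lt|ge] := ltnP k (d v (g (g v))).
  constructor 3; set D := k - (d v (g (g v)))./2.
  have [x [vx xv]] : exists x, d v x = D /\ d v (g v) = D + d x (g v).
    by apply: between_ex; lia.
  have X1 := A v x; have X2 := A x (g v); have X3 := A (g v) (g x).
  have X4 := A (g x) (g (g v)); have X5 := A x (g x).
  have t1 := dist_triangle v (g x) (g v).
  have e1 : d v (g x) = k - D by fp v (g v) (g (g v)) (g x); dlia.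
  have e2 : d x (g x) = k - 2 * D.
    by fp v (g v) x (g x); have := dist_triangle v x (g x); dlia.
  have X6 := A v (g x).
  have e3 : d v (g (g x)) = 2 * k - 3 * D by fp v (g v) (g (g v)) (g (g x)); dlia.
  have e4 : d x (g (g x)) = 2 * (k - 2 * D).
    have := dist_triangle v x (g (g x)); have := dist_triangle x (g x) (g (g x)).
    by dlia.
  by exists x; rewrite /axial; split; lia.
have [odk|evk] := boolP (odd k).
  constructor 2.
  have [x [vx xv]] : exists x, d v x = k./2 /\ d v (g v) = k./2 + d x (g v).
    by apply: between_ex; lia.
  have [y [vy yv]] : exists y, d v y = k./2.+1 /\ d v (g v) = k./2.+1 + d y (g v).
    by apply: between_ex; lia.
  have X1 := A v x; have X2 := A x (g v); have Y1 := A v y; have Y2 := A y (g v).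
  have t1 := dist_triangle v (g x) (g v); have t2 := dist_triangle v (g y) (g v).
  have xy : g x = y.
    apply: (@between_unique _ v (g v)); fp v (g v) (g (g v)) (g x); dlia.
  have yx : g y = x.
    apply: (@between_unique _ v (g v)); fp v (g v) (g (g v)) (g y); dlia.
  exists x, y; split; try lia; split=> //; apply: dist1_adj.
  fp v (g v) x y; have := dist_triangle v x y; dlia.
constructor 1.
have [x [vx xv]] : exists x, d v x = k./2 /\ d v (g v) = k./2 + d x (g v).
  by apply: between_ex; lia.
have X1 := A v x; have X2 := A x (g v).
have t1 := dist_triangle v (g x) (g v).
exists x; last by lia.
by apply: (@between_unique _ v (g v)); fp v (g v) (g (g v)) (g x); dlia.
Qed.

Lemma axial_iter g x n : axial g x -> d x (iter n g x) = n * d x (g x).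
Proof.
rewrite /axial => ax; have [gx|gx] := eqVneq (d x (g x)) 0.
  rewrite gx muln0; elim: n => [|n IH] /=; first exact: distxx.
  by rewrite -(dist_eq0 IH) gx.
have A m : d (iter m g x) (iter m.+1 g x) = d x (g x).
  by elim: m => //= m IH; rewrite dist_aut.
have B m : d (iter m g x) (iter m.+2 g x) = 2 * d x (g x).
  by elim: m => [|m IH] //; rewrite !(iterS _ g) dist_aut.
have : d x (iter n g x) = n * d x (g x) /\ d x (iter n.+1 g x) = n.+1 * d x (g x).
  elim: n => [|n [IH1 IH2]]; first by rewrite distxx mul1n mul0n.
  split=> //; have an := A n; have bn := B n; have an1 := A n.+1.
  rewrite (@geodesic_overlap x (iter n g x) (iter n.+1 g x)) //; try lia.
  by move=> e; rewrite -e distxx in an; lia.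
by case.
Qed.

Lemma elliptic_bounded g x : elliptic g -> exists C, forall n, d x (iter n g x) <= C.
Proof.
case=> [[u gu]|[u [v [uv gu gv]]]].
  exists (2 * d x u) => n; have := dist_triangle x u (iter n g x).
  suff : d u (iter n g x) = d u x by dlia.
  by elim: n => //= n IH; rewrite -{1}gu dist_aut.
exists (2 * d x u).+1 => n; have := dist_triangle x u (iter n g x).
suff : d u (iter n g x) <= (d u x).+1 /\ d v (iter n g x) <= (d u x).+1 by dlia.
have := dist_adj uv; have := dist_triangle v u x => ? ?.
elim: n => [|n [IH1 IH2]] /=; first by dlia.
by rewrite -{1}gv -{2}gu !dist_aut.
Qed.

(** An axial vertex that moves has an unbounded orbit. *)
Lemma axial_hyperbolic g x : axial g x -> 0 < d x (g x) -> hyperbolic g.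
Proof.
move=> ax gx /(elliptic_bounded x)[C H].
by have := H C.+1; rewrite axial_iter //; nia.
Qed.

(** Orbits at bounded distance from each other have the same speed. *)
Lemma axial_same g x y : axial g x -> axial g y -> d x (g x) = d y (g y).
Proof.
suff H a b : axial g a -> axial g b -> d a (g a) <= d b (g b).
  by move=> ? ?; apply/eqP; rewrite eqn_leq !H.
move=> ax bx; pose n := (2 * d a b).+1.
have := axial_iter n ax; have := axial_iter n bx.
have : d (iter n g a) (iter n g b) = d a b by elim: (n) => //= m IH; rewrite dist_aut.
have := dist_triangle a b (iter n g a).
have := dist_triangle b (iter n g b) (iter n g a).
rewrite /n; move: (iter _ _ a) (iter _ _ b) => a' b'; dist_syms; nia.
Qed.

(** The displacement by [g^2] beyond that by [g] turns out to be the same at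
every vertex; the minimum only serves to name its value. *)
Definition translation_len g : nat :=
  nat_min [set d x (g (g x)) - d x (g x) | x in [set: T]].

Lemma elliptic_backtracks g v : elliptic g -> d v (g (g v)) - d v (g v) = 0.
Proof.
move=> ell; case: (translation_trichotomy g v) => [[x gx e]|[x [y [[xy gx gy] e f]]]|].
- have := dist_triangle v x (g (g v)).
  by have := dist_aut g x (g v); rewrite gx; have := dist_aut g x v; rewrite gx; dlia.
- have := dist_triangle v x (g (g v)).
  by have := dist_aut g y (g v); rewrite gy; have := dist_aut g x v; rewrite gx; dlia.
by move=> [x [ax gx _ _]]; case: (axial_hyperbolic ax gx).
Qed.

Lemma translation_lenE g v : translation_len g = d v (g (g v)) - d v (g v).
Proof.
suff H u w : d u (g (g u)) - d u (g u) = d w (g (g w)) - d w (g w).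
  rewrite /translation_len; set A := (X in nat_min X).
  have /nat_minP[[x _ <-] _] : A !=set0 by exists (d v (g (g v)) - d v (g v)), v.
  exact: H.
have [ell|hyp] := pselect (elliptic g); first by rewrite !elliptic_backtracks.
have H a : exists2 x, axial g x & d a (g (g a)) - d a (g a) = d x (g x).
  case: (translation_trichotomy g a) => [[x gx _]|[x [y [xy _ _]]]|].
  - by case: hyp; left; exists x.
  - by case: hyp; right; exists x, y.
  by move=> [x [ax _ ? ?]]; exists x => //; lia.
have [x ax ->] := H u; have [y ay ->] := H w; exact: axial_same ax ay.
Qed.

Lemma translation_len_le g v : translation_len g <= d v (g v).
Proof.
by rewrite (translation_lenE g v); have := dist_triangle v (g v) (g (g v)); rewrite dist_aut; lia.
Qed.

Lemma axial_len g x : axial g x -> translation_len g = d x (g x).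
Proof. by rewrite (translation_lenE g x) => ->; lia. Qed.

Lemma elliptic_len g : elliptic g <-> translation_len g = 0.
Proof.
have [v] := tree_inhabited T.
split=> [/elliptic_backtracks H|]; rewrite (translation_lenE g v) //.
case: (translation_trichotomy g v) => [[x gx _] _|[x [y [xy _ _]]] _|].
- by left; exists x.
- by right; exists x, y.
by move=> [x [_ ? ? ?]]; lia.
Qed.

Lemma hyperbolic_len g : hyperbolic g <-> 0 < translation_len g.
Proof. by rewrite /hyperbolic elliptic_len; lia. Qed.

Lemma fixed_axial g x : g x = x -> axial g x.
Proof. by rewrite /axial => e; rewrite !e distxx. Qed.

Lemma translation_lenV g : translation_len (g^-1)%g = translation_len g.
Proof.
have [v] := tree_inhabited T.
rewrite (translation_lenE _ (g (g v))) !autKg (translation_lenE g v).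
by rewrite dist_aut; dlia.
Qed.

(** The geodesic from [v] to [g v] runs to an axial vertex, along its
displacement, and back by a segment of the same length. *)
Lemma displacement g v : (exists x, axial g x) -> exists2 x, axial g x &
  d v (g v) = 2 * d v x + translation_len g.
Proof.
move=> [y ay]; case: (translation_trichotomy g v) => [[x gx e]|[x [z [xz e f]]]|].
- exists x; first exact: fixed_axial.
  have -> : translation_len g = 0 by apply/elliptic_len; left; exists x.
  by lia.
- have l0 : translation_len g = 0 by apply/elliptic_len; right; exists x, z.
  have gy : g y = y by apply/esym/dist_eq0; rewrite -(axial_len ay).
  have := dist_aut g x y; have := dist_aut g z y; rewrite gy.
  case: xz => xz -> ->.
  by case: (dist_adj_cases y xz); dlia.
move=> [x [ax _ e _]]; exists x => //; by rewrite (axial_len ax).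
Qed.

Lemma axial_min g x : (exists y, axial g y) -> d x (g x) = translation_len g -> axial g x.
Proof.
move=> /(displacement x)[y ay ->] e; suff -> : x = y by [].
by apply: dist_eq0; lia.
Qed.

Lemma hyperbolic_axial g : hyperbolic g -> exists x, axial g x.
Proof.
have [v] := tree_inhabited T => hyp.
case: (translation_trichotomy g v) => [[x gx _]|[x [z [xz _ _]]]|].
- by case: hyp; left; exists x.
- by case: hyp; right; exists x, z.
by move=> [x [ax _ _ _]]; exists x.
Qed.

Lemma noninversion_axial g : (forall u v, ~ inverts g u v) -> exists x, axial g x.
Proof.
move=> ninv; have [[[x gx]|[u [v /ninv//]]]|/hyperbolic_axial//] := pselect (elliptic g).
by exists x; exact: fixed_axial.
Qed.

(** Displacement is convex along geodesics. *)
Lemma axial_convex g x y z : axial g x -> axial g z -> d x z = d x y + d y z -> axial g y.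
Proof.
move=> ax az e; apply: axial_min; first by exists x.
have := translation_len_le g y; have := axial_len ax; have := axial_len az.
have := dist_aut g x y; have := dist_aut g y z; have := dist_aut g x z.
fp y (g y) x z; fp (g y) z (g x) (g z); fp (g y) x (g x) (g z).
have := dist_triangle z x (g x); have := dist_triangle x z (g z); dlia.
Qed.

(** If the axial vertices of [g] and [h] do not meet, [g h] translates along the
bridge between them twice. *)
Lemma axial_meet g h : (exists x, axial g x) -> (exists y, axial h y) ->
  translation_len (g * h)%g <= translation_len g + translation_len h ->
  exists2 x, axial g x & axial h x.
Proof.
move=> [x0 ax0] [y0 ay0] le.
pose A := [set n | exists x y, [/\ axial g x, axial h y & d x y = n]].
have /nat_minP[] : A !=set0 by exists (d x0 y0), x0, y0.
move=> [x [y [ax ay]]]; set D := nat_min A => xyD Dmin.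
have [D0|Dpos] := posnP D.
  by rewrite D0 in xyD; exists x => //; rewrite (dist_eq0 xyD).
have J1 : d y (g y) = 2 * D + translation_len g.
  have [x' ax' e] := displacement y (ex_intro _ x ax).
  have := Dmin (d x' y) (ex_intro _ x' (ex_intro _ y (And3 ax' ay erefl))).
  have := dist_triangle y x (g y); have := dist_triangle x (g x) (g y).
  by rewrite dist_aut -(axial_len ax); dlia.
have J2 : d x (h x) = 2 * D + translation_len h.
  have [y' ay' e] := displacement x (ex_intro _ y ay).
  have := Dmin (d x y') (ex_intro _ x (ex_intro _ y' (And3 ax ay' erefl))).
  have := dist_triangle x y (h x); have := dist_triangle y (h y) (h x).
  by rewrite dist_aut -(axial_len ay); dlia.
have lg := axial_len ax; have lh := axial_len ay.
have xy : x <> y by move=> e; rewrite e distxx in xyD; lia.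
pose p := (h^-1)%g x.
have hp : h p = x by exact: autVKg.
have px : d p x = 2 * D + translation_len h by rewrite /p dist_autV.
have py : d p y = D + translation_len h.
  have := dist_autV h x y; rewrite -/p => py.
  by have := dist_triangle x y (h y); have := dist_triangle p y x; dlia.
have xgy : d x (g y) = D + translation_len g.
  have := dist_triangle x (g x) (g y); rewrite dist_aut.
  by have := dist_triangle y x (g y); dlia.
have pgy : d p (g y) = 3 * D + translation_len h + translation_len g.
  by rewrite (@geodesic_overlap p y x (g y)); try dlia; exact: nesym.
have pgx : d p (g x) = 2 * D + translation_len h + translation_len g.
  have := dist_triangle p x (g x); have := dist_triangle p (g x) (g y).
  by rewrite dist_aut; dlia.
have ghp2 : d (g y) (g (h (g x))) = D + translation_len h + translation_len g.
  have [z hz] : exists z, h z = y by exists ((h^-1)%g y); exact: autVKg.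
  have pz : d p z = D by rewrite -(dist_aut h) hp hz.
  have zx : d z (g x) = D + translation_len h + translation_len g.
    have := dist_triangle p z (g x); have := dist_triangle z y (g x).
    have zy : d z y = translation_len h.
      by rewrite lh -(dist_aut h) hz.
    by have := dist_triangle p y (g x); have := dist_triangle y x (g x); dlia.
  by rewrite -hz !dist_aut.
have gxq : d (g x) (g (h (g x))) = 2 * D + translation_len h + translation_len g.
  by rewrite -hp !dist_aut hp.
have gxy : d (g x) (g y) = D by rewrite dist_aut.
have pq : d p (g (h (g x))) = 2 * (2 * D + translation_len h + translation_len g).
  rewrite (@geodesic_overlap p (g x) (g y) (g (h (g x)))); try lia.
  by move=> /aut_inj.
exfalso; move: le; rewrite (translation_lenE _ p) /= hp pq pgx; lia.
Qed.

Definition length_additive (G S : set (aut T)) :=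
  [/\ S `<=` G, (forall g h, S g -> S h -> S (g * h)%g) &
      forall g h, S g -> S h ->
        translation_len (g * h)%g = translation_len g + translation_len h].

End Translation.

(** * Inversions *)

Section Inversions.
Variable T : tree.
Implicit Types (u v x y z w : T) (g h : aut T).

Local Notation d := (@dist T).

Lemma edge_translation (f : aut T) x y n : adj x y -> d x (f x) = n.+1 -> d y (f y) = n.+1 ->
  d x (f y) = n.+2 -> d y (f x) = n -> translation_len f = n.+1.
Proof.
move=> /dist_adj xy xx yy xfy yfx.
have e : d x (f (f x)) = 2 * n.+1.
  rewrite (@geodesic_overlap _ x (f x) (f y) (f (f x))) ?dist_aut ?xx ?xy; try dlia.
  by move=> /aut_inj e; rewrite e distxx in xy.
by rewrite (translation_lenE f x) e xx; lia.
Qed.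

(** If [h] moves the inverted edge off itself, then either both edges point the
same way along the geodesic joining them, and [g h] translates less than [h],
or they do not, and it translates more. *)
Lemma inversion_preserves_edge g h u v : inverts g u v ->
  translation_len (g * h)%g = translation_len h ->
  (h u = u /\ h v = v) \/ (h u = v /\ h v = u).
Proof.
move=> [uv gu gv] e.
have uv1 := dist_adj uv; have huv : d (h u) (h v) = 1 by rewrite dist_aut.
have Vu x y : d ((h^-1)%g x) y = d x (h y) := dist_autV h x y.
have Lu : translation_len (g * h)%g <= d u (h v).
  by have := translation_len_le (g * h)%g ((h^-1)%g u); rewrite /= autVKg gu Vu.
have Lv : translation_len (g * h)%g <= d v (h u).
  by have := translation_len_le (g * h)%g ((h^-1)%g v); rewrite /= autVKg gv Vu.
have hu := translation_len_le h u; have hv := translation_len_le h v.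
have huv' : adj (h u) (h v) by rewrite aut_adj.
have vu : adj v u by rewrite adj_sym.
have E1 n := @edge_translation h u v n uv.
have E2 n := @edge_translation h v u n vu.
have F1 n := @edge_translation (g * h)%g ((h^-1)%g u) ((h^-1)%g v) n.
have F2 n := @edge_translation (g * h)%g ((h^-1)%g v) ((h^-1)%g u) n.
rewrite /= !autVKg gu gv !Vu in F1 F2; rewrite aut_inv_adj in F1; rewrite aut_inv_adj in F2.
have {}F1 n := F1 n uv; have {}F2 n := F2 n vu.
have [c1 c2] := (dist_adj_cases u huv', dist_adj_cases v huv').
have c3 := dist_adj_cases (h u) uv; have c4 := dist_adj_cases (h v) uv.
have := four_point u (h u) v (h v); have := four_point u (h v) v (h u).
rewrite uv1 huv (dist_sym (h v) (h u)) huv (dist_sym (h u) v) (dist_sym (h v) v) => fp1 fp2.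
rewrite !(dist_sym (h u)) in c3; rewrite !(dist_sym (h v)) in c4.
(* The edge and its image are equal, or disjoint with one of four relative
   orientations. *)
have {c1 c2 c3 c4 fp1 fp2} : (d u (h u) = 0 /\ d v (h v) = 0) \/
     (d v (h u) = 0 /\ d u (h v) = 0) \/
     (d u (h u) = (d v (h u)).+1 /\ d v (h v) = (d v (h u)).+1 /\
      d u (h v) = (d v (h u)).+2) \/
     (d v (h v) = (d u (h v)).+1 /\ d u (h u) = (d u (h v)).+1 /\
      d v (h u) = (d u (h v)).+2) \/
     (d u (h v) = (d v (h v)).+1 /\ d v (h u) = (d v (h v)).+1 /\
      d u (h u) = (d v (h v)).+2) \/
     (d v (h u) = (d u (h u)).+1 /\ d u (h v) = (d u (h u)).+1 /\
      d v (h v) = (d u (h u)).+2).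
  move: c1 c2 c3 c4 fp1 fp2; clear.
  move: (d u (h u)) (d v (h v)) (d u (h v)) (d v (h u)) => a b c e.
  move=> [] c1 [] c2 [] c3 [] c4 f1 f2;
    first [ left; lia | right; left; lia | do 2 right; left; lia
          | do 3 right; left; lia | do 4 right; left; lia | do 5 right; lia ].
clear Vu huv' uv1 huv.
move=> [[a0 b0]|[[a0 b0]|[[a [b c]]|[[a [b c]]|[[a [b c]]|[a [b c]]]]]]].
- by left; split; apply/esym/dist_eq0.
- by right; split; apply/esym/dist_eq0.
- by have {E1 E2 F1 F2} := E1 _ a b c erefl; lia.
- by have {E1 E2 F1 F2} := E2 _ a b c erefl; lia.
- by have {E1 E2 F1 F2} := F1 _ a b c erefl; lia.
by have {E1 E2 F1 F2} := F2 _ a b c erefl; lia.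
Qed.

End Inversions.

(** * Lines, rays and ends *)

Section Lines.
Variable T : tree.
Implicit Types (u v x y z w : T) (g h : aut T) (c : int -> T) (r s : nat -> T).

Local Notation d := (@dist T).

(** The axis is the union of the geodesics between the iterates of [x] under
[g^-1] and [g]; a vertex is located by its distances from the ends of any long
enough one. *)
Lemma axis_ex g x : axial g x -> 0 < d x (g x) -> exists c,
  [/\ is_line c, c 0%R = x &
      forall n : int, g (c n) = c (n + (translation_len g)%:Z)%R].
Proof.
move=> ax; rewrite -(axial_len ax); set k := translation_len g => kpos.
pose A n := iter n (g^-1)%g x; pose B n := iter n g x.
have gA n : g (A n.+1) = A n by rewrite /A /= autVKg.
have xB n : d x (B n) = n * k by rewrite axial_iter // -(axial_len ax).
have AB n m : d (A n) (B m) = (n + m) * k.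
  elim: n m => [|n IH] m; first by rewrite add0n -xB.
  by rewrite -(dist_aut g) gA -[g (B m)]/(B m.+1) IH addnS.
have AA n m : d (A (n + m)) (A n) = m * k.
  elim: n => [|n IH]; last by rewrite addSn -(dist_aut g) !gA.
  by rewrite add0n; have := AB m 0; rewrite addn0.
have BB n m : d (B n) (B (n + m)) = m * k.
  by elim: n => [|n IH]; [rewrite add0n xB | rewrite addSn /B /= dist_aut].
pose P N (n : int) z :=
  Posz (d (A N) z) = (n + Posz (N * k))%R /\ Posz (d z (B N)) = (Posz (N * k) - n)%R.
have Pex (n : int) : exists z, P `|n|%N n z.
  have := AB `|n|%N `|n|%N; set N := `|n|%N => e.
  have ge : N <= N * k by rewrite leq_pmulr.
  have [z [z1 z2]] : exists z, d (A N) z = `|(n + Posz (N * k))%R|%N /\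
     d (A N) (B N) = `|(n + Posz (N * k))%R|%N + d z (B N).
    by apply: between_ex; rewrite mulnDl in e; lia.
  exists z; split; rewrite mulnDl in e; lia.
have [c Pc] := choice Pex.
have Pmon N m n z : P N n z -> P (N + m) n z.
  move=> [h1 h2]; have := AB (N + m) (N + m); have := AA N m; have := BB N m.
  have := dist_triangle (A (N + m)) (A N) z; have := dist_triangle z (B N) (B (N + m)).
  have := dist_triangle (A (N + m)) z (B (N + m)).
  by rewrite /P !mulnDl; dlia.
have Pbig N n : `|n|%N <= N -> P N n (c n).
  by move=> le; rewrite -(subnKC le); apply: Pmon.
exists c; split.
- move=> m n; set N := maxn `|m|%N `|n|%N.
  have [m1 m2] : P N m (c m) by apply: Pbig; lia.
  have [n1 n2] : P N n (c n) by apply: Pbig; lia.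
  have e := AB N N; rewrite mulnDl in e.
  have := dist_triangle (A N) (c m) (c n); have := dist_triangle (A N) (c n) (c m).
  by fp (A N) (B N) (c m) (c n); dlia.
- have [+ _] := Pbig 0 0%R (leqnn 0); rewrite mul0n addr0 => /eqP.
  by rewrite eqz_nat => /eqP /dist_eq0.
move=> n; set N := `|n|%N + `|(n + Posz k)%R|%N.
have [m1 m2] : P N.+1 (n + Posz k)%R (c (n + Posz k)%R) by apply: Pbig; lia.
have [n1 _] : P N.+2 n (c n) by apply: Pbig; lia.
have [_ n2] : P N n (c n) by apply: Pbig; lia.
have AB' := AB N.+1 N.+1; rewrite mulnDl in AB'.
rewrite -(dist_aut g) gA in n1; rewrite -(dist_aut g) -[g (B N)]/(B N.+1) in n2.
by apply: (@between_unique _ (A N.+1) (B N.+1)); lia.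
Qed.

Lemma is_rayP r : is_ray r <-> forall m n, d (r m) (r (m + n)) = n.
Proof.
split=> [rr m n|H m n]; first by rewrite rr; lia.
by have [le|/ltnW le] := leqP m n; rewrite -(subnKC le) ?H 1?dist_sym ?H; lia.
Qed.

Lemma ray_dist r m n : is_ray r -> d (r m) (r (m + n)) = n.
Proof. by move/is_rayP. Qed.

Lemma ray_shift r a : is_ray r -> is_ray (fun n => r (n + a)).
Proof. by move=> rr m n; rewrite rr; lia. Qed.

Lemma ray_aut g r : is_ray r -> is_ray (g \o r).
Proof. by move=> rr m n; rewrite /= dist_aut. Qed.

Lemma line_aut g c : is_line c -> is_line (g \o c).
Proof. by move=> cc m n; rewrite /= dist_aut. Qed.

Lemma line_shift c (a : int) : is_line c -> is_line (fun n => c (n + a)%R).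
Proof. by move=> cc m n; rewrite cc; lia. Qed.

Lemma line_rev c : is_line c -> is_line (fun n => c (- n)%R).
Proof. by move=> cc m n; rewrite cc; lia. Qed.

Lemma line_inj c m n : is_line c -> c m = c n -> m = n.
Proof. by move=> cc e; have := cc m n; rewrite e distxx; lia. Qed.

Definition pos_ray c (n : nat) := c (Posz n).
Definition neg_ray c (n : nat) := c (- Posz n)%R.

Lemma pos_rayP c : is_line c -> is_ray (pos_ray c).
Proof. by move=> cc m n; rewrite cc. Qed.

Lemma neg_rayP c : is_line c -> is_ray (neg_ray c).
Proof. by move=> cc m n; rewrite cc; lia. Qed.

Lemma isometry_nat_int (f : nat -> int) :
  (forall m n, `|f m - f n|%N = `|Posz m - Posz n|%N) ->
  (forall n, f n = (f 0%N + n%:Z)%R) \/ (forall n, f n = (f 0%N - n%:Z)%R).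
Proof.
move=> H; have := H 1 0.
have [e _|ne e1] := pselect (f 1%N = f 0%N + 1)%R; [left|right] => n.
  elim/ltn_ind: n => -[|[|n]] IH; try lia.
  by have := IH n.+1 (ltnSn _); have := IH n; have := H n.+2 n.+1; have := H n.+2 n; lia.
elim/ltn_ind: n => -[|[|n]] IH; try lia.
by have := IH n.+1 (ltnSn _); have := IH n; have := H n.+2 n.+1; have := H n.+2 n; lia.
Qed.

(** For rays this is equivalence; the parameters record the relative shift. *)
Definition tails r s := exists a b, forall n, r (n + a) = s (n + b).

Lemma tails_sym r s : tails r s -> tails s r.
Proof. by move=> [a [b H]]; exists b, a. Qed.

Lemma tails_trans r s t : tails r s -> tails s t -> tails r t.
Proof.
move=> [a [b H]] [a' [b' H']]; exists (a + a'), (b' + b) => n.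
by rewrite (addnC a) addnA H addnAC H' -addnA (addnC b).
Qed.

Lemma tails_aut g r s : tails r s -> tails (g \o r) (g \o s).
Proof. by move=> [a [b H]]; exists a, b => n /=; rewrite H. Qed.

(** A subray of a ray is one of its tails, and the intersection of two rays is
convex. *)
Lemma ray_equivP r s : is_ray r -> is_ray s -> ray_equiv r s <-> tails r s.
Proof.
move=> rr ss; split=> [[t tt e]|[a0 [b0 H0]]].
  have tail (q : nat -> T) : is_ray q -> range t `<=` range q ->
      exists a, forall n, t n = q (n + a).
    move=> qq sub; have /choice[f Hf] n : exists m, q m = t n.
      by have [|m _ <-] := sub (t n); [exists n | exists m].
    have : forall m n, `|Posz (f m) - Posz (f n)|%N = `|Posz m - Posz n|%N.
      by move=> m n; rewrite -(qq (f m) (f n)) !Hf tt.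
    move=> /(isometry_nat_int (f := fun n => Posz (f n)))[H|H].
      by exists (f 0) => n; rewrite -Hf; congr q; have := H n; lia.
    by have := H (f 0).+1; lia.
  have [|a Ha] := tail r rr; first by rewrite -e; apply: subIsetl.
  have [|b Hb] := tail s ss; first by rewrite -e; apply: subIsetr.
  by exists a, b => n; rewrite -Ha -Hb.
have ex : exists a, `[< range s (r a) >].
  by exists (0 + a0); apply/asboolP; rewrite H0; exists (0 + b0).
case: (ex_minnP ex) => a /asboolP[b _ ba] amin.
have aa0 : a <= a0.
  by apply: amin; apply/asboolP; exists b0 => //; have := H0 0.
have mem n : range s (r (n + a)).
  pose N := n + a0.
  have sN : s (N + b0) = r (N + a0) by rewrite H0.
  have rd := ray_dist (n + a) (N + a0 - (n + a)) rr.
  have sd : d (s b) (s (N + b0)) = N + a0 - a.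
    by rewrite ba sN rr; lia.
  have rd' : d (r a) (r (n + a)) = n by rewrite rr; lia.
  have rd2 : d (r (n + a)) (r (N + a0)) = N + a0 - (n + a) by rewrite rr; lia.
  have sd' := sd; rewrite ss in sd'.
  exists (if b <= N + b0 then b + n else b - n) => //.
  apply: (@between_unique _ (s b) (s (N + b0))).
  - by rewrite !ss; case: ifP; lia.
  - by rewrite sd ba sN rd' rd2; lia.
  by rewrite ss ba rd'; case: ifP; lia.
exists (fun n => r (n + a)); first exact: ray_shift.
apply/seteqP; split=> [x [[n _ <-] sn]|x [n _ <-]]; last by split=> //; exists (n + a).
have le : a <= n by apply: amin; apply/asboolP.
by exists (n - a) => //; rewrite subnK.
Qed.

Lemma end_ofE r s : is_ray r -> end_of r s <-> is_ray s /\ tails r s.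
Proof. by move=> rr; split=> -[ss H]; split=> //; apply/(ray_equivP rr ss). Qed.

Lemma end_of_eq r s : is_ray r -> is_ray s -> end_of r = end_of s <-> tails r s.
Proof.
move=> rr ss; split=> [e|t].
  have : end_of s s by apply/end_ofE => //; split=> //; exists 0, 0.
  by rewrite -e => /(end_ofE _ rr)[].
apply/seteqP; split=> q /end_ofE [] // qq t'; apply/end_ofE => //; split=> //.
  exact: tails_trans (tails_sym t) t'.
exact: tails_trans t t'.
Qed.

Lemma end_act_of g r : is_ray r -> end_act g (end_of r) = end_of (g \o r).
Proof.
move=> rr; have gr := ray_aut g rr; apply/seteqP; split=> [_ [q /(end_ofE _ rr)[qq t] <-]|q].
  by apply/end_ofE => //; split; [exact: ray_aut | exact: tails_aut].
move=> /(end_ofE _ gr)[qq t]; exists ((g^-1)%g \o q); last by apply/funext => n /=; rewrite autVKg.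
apply/end_ofE => //; split; first exact: ray_aut.
have := tails_aut (g^-1)%g t; congr tails.
by apply/funext => n; exact: autK.
Qed.

Lemma line_ends_neq c : is_line c -> ~ tails (pos_ray c) (neg_ray c).
Proof.
by move=> cc [a [b H]]; have := line_inj cc (H 0); have := line_inj cc (H 1); lia.
Qed.

(** Only one geodesic joins two far vertices common to both lines. *)
Lemma line_unique c c' : is_line c -> is_line c' -> tails (pos_ray c) (pos_ray c') ->
  tails (neg_ray c) (neg_ray c') -> exists k : int, forall n, c n = c' (n + k)%R.
Proof.
move=> cc cc' [a [b H]] [a' [b' H']]; exists (b%:Z - a%:Z)%R => n.
have ab : (b%:Z - a%:Z = a'%:Z - b'%:Z)%R.
  have := cc (Posz a) (- Posz a')%R; have := H 0; have := H' 0.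
  rewrite /pos_ray /neg_ray !add0n => -> ->; rewrite cc'; lia.
pose N := `|n|%N.
have e1 : c (Posz (N + a)) = c' (Posz (N + b)) := H N.
have e2 : c (- Posz (N + a'))%R = c' (- Posz (N + b'))%R := H' N.
apply: (@between_unique _ (c (- Posz (N + a'))%R) (c (Posz (N + a)))).
- by rewrite !cc; lia.
- by rewrite e1 e2 !cc'; lia.
by rewrite cc e2 cc'; lia.
Qed.

End Lines.

Section Dynamics.
Variable T : tree.
Implicit Types (u v x y z w : T) (g h : aut T) (c : int -> T) (r s : nat -> T).

Local Notation d := (@dist T).

Lemma iter_line g c (k : int) m n : (forall n, g (c n) = c (n + k)%R) ->
  iter m g (c n) = c (n + Posz m * k)%R.
Proof.
move=> H; elim: m => [|m IH] /=; first by congr c; lia.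
by rewrite IH H; congr c; lia.
Qed.

Lemma line_axial g c (k : nat) n : is_line c -> (forall n, g (c n) = c (n + Posz k)%R) ->
  axial g (c n) /\ translation_len g = k.
Proof.
move=> cc H; have ax : axial g (c n) by rewrite /axial !H !cc; lia.
by split=> //; rewrite (axial_len ax) H cc; lia.
Qed.

(** The orbit of [y] lies on a geodesic that stays at bounded distance from the
line in both directions; such geodesics coincide. *)
Lemma axis_mem g c (k : nat) y : is_line c -> 0 < k ->
  (forall n, g (c n) = c (n + Posz k)%R) -> axial g y -> exists n, y = c n.
Proof.
move=> cc kpos H ay; pose e := d (c 0%R) y; pose N := e.+1.
have [a0 lk] := line_axial 0%R cc H.
have yk : d y (g y) = k by rewrite -lk (axial_len ay).
have Nk : e < N * k by rewrite leq_pmulr.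
pose y1 := iter N g y; pose y2 := iter N g y1.
have y12 : d y y1 = N * k by rewrite axial_iter // yk.
have iterd m a b : d (iter m g a) (iter m g b) = d a b.
  by elim: m => //= m IH; rewrite dist_aut.
have y23 : d y1 y2 = N * k by rewrite -y12 -(iterd N y y1).
have y13 : d y y2 = 2 * (N * k).
  by rewrite /y2 /y1 -iterD axial_iter // yk mulnDl mul2n addnn.
have c1 : iter N g (c 0%R) = c (Posz (N * k)) by rewrite (iter_line _ _ H); congr c; lia.
have c2 : iter N g (c (Posz (N * k))) = c (Posz (2 * (N * k))).
  by rewrite (iter_line _ _ H); congr c; lia.
have e0 : d (c 0%R) y = e by [].
have e1 : d (c (Posz (N * k))) y1 = e by rewrite -c1 iterd.
have e2 : d (c (Posz (2 * (N * k)))) y2 = e by rewrite -c2 iterd.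
have c02 : d (c 0%R) (c (Posz (2 * (N * k)))) = 2 * (N * k) by rewrite cc; lia.
move: (N * k) Nk y12 y23 y13 c1 c2 e1 e2 c02 => M Nk y12 y23 y13 c1 c2 e1 e2 c02.
set B := c (Posz (2 * M)) in c02 e2; set A := c 0%R in c02 e0.
have yB : d y B = M + d y1 B.
  by fp y y1 y2 B; have := dist_triangle y y1 B; have := dist_triangle y y2 B; have := dist_triangle y1 B y2; dlia.
have AB : d A B = d A y1 + d y1 B.
  fp A y y1 B; have := dist_triangle A y1 B; have := dist_triangle A y B.
  by have := dist_triangle y1 y2 B; have := dist_triangle y A B; dlia.
have le : d A y1 <= 2 * M by lia.
have y1c : y1 = c (Posz (d A y1)).
  apply: (@between_unique _ A B); first exact: AB.
    by move: (d A y1) le => p le; rewrite /A /B !cc; lia.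
  by rewrite /A [RHS]cc sub0r abszN.
exists (Posz (d A y1) - Posz N * Posz k)%R.
have := iter_line N (Posz (d A y1) - Posz N * Posz k)%R H.
rewrite subrK -y1c /y1.
have inj m a b : iter m g a = iter m g b -> a = b.
  by elim: m a b => //= m IH a b /aut_inj /IH.
by move/inj.
Qed.

Lemma end_fixP g r : is_ray r -> end_act g (end_of r) = end_of r <->
  exists a b, forall n, g (r (n + a)) = r (n + b).
Proof.
move=> rr; rewrite end_act_of // end_of_eq //; exact: ray_aut.
Qed.

Lemma shift_len g r a b : is_ray r -> a <= b ->
  (forall n, g (r (n + a)) = r (n + b)) ->
  axial g (r a) /\ translation_len g = b - a.
Proof.
move=> rr le H; have e1 : g (r a) = r b by rewrite (H 0).
have e2 : g (r b) = r (b - a + b) by rewrite -H subnK.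
have ax : axial g (r a) by rewrite /axial e1 e2 !rr; lia.
by split=> //; rewrite (axial_len ax) e1 rr; lia.
Qed.

Lemma shiftV g r a b : (forall n, g (r (n + a)) = r (n + b)) ->
  forall n, (g^-1)%g (r (n + b)) = r (n + a).
Proof. by move=> H n; rewrite -H autKg. Qed.

Lemma shift_attracting g r a b : is_ray r -> a < b ->
  (forall n, g (r (n + a)) = r (n + b)) -> attracting_end g (end_of r).
Proof.
move=> rr lt H; have [ax l] := shift_len rr (ltnW lt) H.
have [|c [cc c0 Hc]] := axis_ex ax; first by rewrite -(axial_len ax); lia.
exists c; first by split=> //; exists (translation_len g); [lia|].
apply/(end_of_eq rr (pos_rayP cc)); exists a, 0 => n; rewrite addn0 /pos_ray.
have e N : iter N g (r a) = r (N * (b - a) + a).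
  elim: N => //= N IH; rewrite IH H; congr r; lia.
have := e n; rewrite -c0 (iter_line _ _ Hc) l => e'.
have le : n <= n * (b - a) by rewrite leq_pmulr //; lia.
have ca : c 0%R = r a := c0.
apply: (@between_unique _ (r a) (r (n * (b - a) + a))).
- by rewrite !rr; lia.
- by rewrite -e' -ca !cc; lia.
by rewrite rr -ca cc; lia.
Qed.

Lemma attracting_shift g r : is_ray r -> attracting_end g (end_of r) ->
  exists a b, a < b /\ forall n, g (r (n + a)) = r (n + b).
Proof.
move=> rr [c [cc [k kpos Hk]] /(end_of_eq rr (pos_rayP cc))[a [b H]]].
exists a, (k + a); split=> [|n]; first lia.
by rewrite H Hk addnA H; congr c; lia.
Qed.

Lemma repellingV g omega : repelling_end g omega <-> attracting_end (g^-1)%g omega.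
Proof.
have H f c : is_axis f c -> is_axis (f^-1)%g (fun n => c (- n)%R).
  move=> [cc [k kpos Hk]]; split; first exact: line_rev.
  exists k => // n; apply: (@aut_inj _ f); rewrite autVKg Hk; congr c; lia.
split=> [[c /H Hc ->]|[c /H + ->]]; first by exists (fun n => c (- n)%R).
rewrite invgK => Hc; exists (fun n => c (- n)%R) => //; congr end_of.
by apply/funext => n; congr c; lia.
Qed.

Lemma ellipticV g : elliptic (g^-1)%g <-> elliptic g.
Proof. by rewrite !elliptic_len translation_lenV. Qed.

Variable G : set (aut T).

(** A shift by zero fixes a vertex, and a shift forwards has a tail of the ray
on its axis; so the sign of the shift decides membership. *)
Lemma fix_end_plusP g r : is_ray r -> fix_end_plus G (end_of r) g <->
  G g /\ exists a b, a <= b /\ forall n, g (r (n + a)) = r (n + b).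
Proof.
move=> rr; split=> [[[Gg /(end_fixP g rr)[a [b H]]] []]|[Gg [a [b [le H]]]]].
- move=> /elliptic_len l0; split=> //; exists a, b; split=> //.
  have [//|lt] := leqP a b.
  have [_] := shift_len rr (ltnW lt) (shiftV H).
  by rewrite translation_lenV l0; lia.
- move=> [_ /(attracting_shift rr)[a' [b' [lt H']]]]; split=> //.
  by exists a', b'; split=> //; exact: ltnW.
split; first by split=> //; apply/(end_fixP g rr); exists a, b.
have [ax l] := shift_len rr le H.
have [e|ne] := eqVneq a b; first by left; apply/elliptic_len; rewrite l e subnn.
right; split; first by apply/hyperbolic_len; lia.
by apply: (shift_attracting rr _ H); lia.
Qed.

Lemma fix_end_minusV g omega : is_subgroup G ->
  fix_end_minus G omega g <-> fix_end_plus G omega (g^-1)%g.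
Proof.
move=> [_ _ GV]; have GE : G (g^-1)%g <-> G g.
  by split=> [/GV|/GV //]; rewrite invgK.
have act f : end_act f omega = omega -> end_act (f^-1)%g omega = omega.
  move=> e; rewrite -[in LHS]e; apply/seteqP; split=> [_ [_ [q qo <-] <-]|q qo].
    suff -> : (f^-1)%g \o (f \o q) = q by [].
    by apply/funext => n /=; exact: autK.
  exists (f \o q); first by exists q.
  by apply/funext => n /=; exact: autK.
have actE : end_act (g^-1)%g omega = omega <-> end_act g omega = omega.
  by split=> [/act|/act//]; rewrite invgK.
rewrite /fix_end_minus /fix_end_plus /fix_end /= repellingV GE actE.
by rewrite /hyperbolic ellipticV.
Qed.

(** * Rays and lines in a branching tree *)

Definition branching := forall v u w, exists t, [/\ adj v t, t <> u & t <> w].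

Lemma valency_branching : locally_finite T -> (forall v, 3 <= valency v) -> branching.
Proof.
move=> fin val v u w; apply: contrapT => no.
have sub : (fset_set (nbrs v) `<=` [fset u; w])%fset.
  apply/fsubsetP => t; rewrite in_fset_set // inE => vt.
  have vt' : adj v t := vt; rewrite !inE; apply/negPn/negP.
  rewrite negb_or => /andP[/eqP tu /eqP tw].
  by apply: no; exists t.
have := fsubset_leq_card sub; have := val v; rewrite /valency cardfs2.
by case: (u != w) => /=; lia.
Qed.

Hypothesis branch : branching.

(** At most one neighbour of a vertex is nearer to [x], so a geodesic from [x]
can always be prolonged. *)
Lemma ray_away x v : exists r, [/\ is_ray r, r 0 = v & forall n, d x (r n) = d x v + n].
Proof.
have step y : exists z, adj y z /\ d x z = (d x y).+1.
  have [t [yt tu _]] := branch y y y; have [t' [yt' _ t't]] := branch y y t.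
  case: (dist_adj_cases x yt) => [?|e]; first by exists t.
  case: (dist_adj_cases x yt') => [?|e']; first by exists t'.
  by case: t't; apply: (@closer_neighbour_unique _ x y); rewrite // e ?e'; lia.
have [f Hf] := choice step; pose r n := iter n f v.
have rx n : d x (r n) = d x v + n.
  by elim: n => [|n IH]; [rewrite addn0 | rewrite /= (Hf _).2 IH addnS].
exists r; split=> //; apply/is_rayP => m n.
have := dist_triangle x (r m) (r (m + n)); rewrite !rx.
suff : d (r m) (r (m + n)) <= n by lia.
elim: n => [|n IH]; first by rewrite addn0 distxx.
have := dist_triangle (r m) (r (m + n)) (r (m + n.+1)); rewrite addnS.
by rewrite [d (r (m + n)) _](dist_adj (Hf _).1); lia.
Qed.

Lemma prepend_ray v r D : is_ray r -> (forall n, d v (r n) = D + n) ->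
  exists s, [/\ is_ray s, s 0 = v & forall n, s (n + D) = r n].
Proof.
move=> rr H.
have ex n : exists z, d v z = n /\ d v (r n) = n + d z (r n).
  by apply: between_ex; rewrite H; lia.
have [s Hs] := choice ex; exists s.
have sr n N : n <= N -> d v (s n) = n /\ d v (r N) = n + d (s n) (r N).
  move=> le; have [s1 s2] := Hs n; split=> //.
  have := dist_triangle (s n) (r n) (r N); have := dist_triangle v (s n) (r N).
  by rewrite !H in s2 *; rewrite (rr n N); lia.
split.
- move=> m n; have [|m1 m2] := sr m (maxn m n); first lia.
  have [|n1 n2] := sr n (maxn m n); first lia.
  have := dist_triangle v (s m) (s n); have := dist_triangle v (s n) (s m).
  by fp v (r (maxn m n)) (s m) (s n); dlia.
- by have [/dist_eq0 <-] := Hs 0.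
move=> n; have [s1 s2] := Hs (n + D).
apply: (@between_unique _ v (r (n + D))) => //; first by lia.
  by rewrite !H rr; lia.
by rewrite H s1; lia.
Qed.

(** From its vertex nearest to [v] on, the ray leads away from [v]. *)
Lemma ray_from r v : is_ray r -> exists s, [/\ is_ray s, s 0 = v & tails s r].
Proof.
move=> rr.
have [[a _ e] mn] := @nat_minP [set d v (r n) | n in [set: nat]] (ex_intro _ (d v (r 0)) (ex_intro2 _ _ 0 I erefl)).
have H n : d v (r (n + a)) = d v (r a) + n.
  have [m [m1 m2 m3]] := median_ex v (r a) (r (n + a)).
  have ran : d (r a) (r (n + a)) = n by rewrite rr; lia.
  have mr : m = r (d (r a) m + a).
    by apply: (@between_unique _ (r a) (r (n + a))); rewrite // ?rr; lia.
  have := mn (d v m); rewrite {1}mr => /(_ (ex_intro2 _ _ (d (r a) m + a) I erefl)).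
  by rewrite -e; dlia.
have [s [ss s0 sr]] := prepend_ray (ray_shift a rr) H.
by exists s; split=> //; exists (d v (r a)), a.
Qed.

Lemma join_rays r s : is_ray r -> is_ray s -> r 0 = s 0 -> r 1 <> s 1 ->
  exists c, [/\ is_line c, pos_ray c = r & neg_ray c = s].
Proof.
move=> rr ss e0 ne.
pose c (n : int) := match n with Posz n => r n | Negz n => s n.+1 end.
have cneg n : c (- Posz n)%R = s n by case: n => //=.
have rs m n : d (r m) (s n) = m + n.
  case: m => [|m]; first by rewrite e0 ss; lia.
  case: n => [|n]; first by rewrite -e0 rr; lia.
  have adj01 : adj (s 0) (s 1) by apply: dist1_adj; rewrite ss.
  have a10 : adj (r 0) (r 1) by apply: dist1_adj; rewrite rr.
  rewrite (@geodesic_concat _ (r m.+1) (s n.+1) (s 0) (s 1)) //.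
  - by rewrite ss -e0 rr; lia.
  - case: (dist_adj_cases (r m.+1) adj01) => // le; case: ne.
    rewrite -e0 rr in le adj01.
    by apply: (@closer_neighbour_unique _ (r m.+1) (r 0)); rewrite // !rr; lia.
  by rewrite !ss; lia.
exists c; split; last 1 first.
- by apply/funext => n; rewrite /neg_ray cneg.
- move=> [m|m] [n|n] /=.
  + by rewrite rr.
  + by rewrite rs; lia.
  + by rewrite dist_sym rs; lia.
  by rewrite ss; lia.
by [].
Qed.

(** Rays from a common vertex to different ends separate at some vertex. *)
Lemma line_between r s : is_ray r -> is_ray s -> ~ tails r s ->
  exists c, [/\ is_line c, tails (pos_ray c) r & tails (neg_ray c) s].
Proof.
move=> rr ss nt; have [s' [ss' s'0 ts']] := ray_from (r 0) ss.
have ex : exists n, r n != s' n.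
  apply: contrapT => no; apply: nt; apply: tails_trans ts'; exists 0, 0 => n.
  by rewrite !addn0; apply: contrapT => /eqP ne; apply: no; exists n.
case: (ex_minnP ex) => -[|m]; first by rewrite s'0 eqxx.
move=> /eqP ne mn.
have em : r m = s' m.
  by apply: contrapT => /eqP /mn; rewrite ltnn.
have [c [cc cr cs]] := join_rays (ray_shift m rr) (ray_shift m ss') em ne.
exists c; split=> //; first by rewrite cr; exists 0, m => n; rewrite addn0.
by rewrite cs; apply: tails_trans ts'; exists 0, m => n; rewrite addn0.
Qed.

Lemma line_extending r : is_ray r -> exists2 c, is_line c & pos_ray c = r.
Proof.
move=> rr; have [s [ss s0 H]] := ray_away (r 1) (r 0).
have ne : r 1 <> s 1 by move=> e; have := H 1; rewrite e distxx -e; lia.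
have [c [cc cr _]] := join_rays rr ss (esym s0) ne.
by exists c.
Qed.

Lemma line_through v y : exists c, [/\ is_line c, c 0%R = v & c (Posz (d v y)) = y].
Proof.
have [r [rr r0 H]] := ray_away v y; have [s [ss s0 sr]] := prepend_ray rr H.
have [c cc cs] := line_extending ss.
exists c; split=> //; first by rewrite -s0 -cs.
by rewrite -[c _]/(pos_ray c _) cs -[d v y]add0n sr.
Qed.

End Dynamics.

(** * Transitivity on lines *)

Section Transitivity.
Variable T : tree.
Implicit Types (u v x y z w : T) (g h : aut T) (c : int -> T) (r s : nat -> T).
Variable G : set (aut T).
Hypothesis Ggrp : is_subgroup G.
Hypothesis G2 : two_transitive_on_ends G.
Hypothesis branch : branching T.

Local Notation d := (@dist T).

Lemma subgroupM g h : G g -> G h -> G (g * h)%g.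
Proof. by have [_ H _] := Ggrp; exact: H. Qed.

Lemma subgroupV g : G g -> G (g^-1)%g.
Proof. by have [_ _ H] := Ggrp; exact: H. Qed.

Lemma line_transport c c' : is_line c -> is_line c' ->
  exists2 g, G g & exists k : int, forall n, g (c n) = c' (n + k)%R.
Proof.
move=> cc cc'.
have E c0 : is_line c0 -> ends T (end_of (neg_ray c0)) /\ ends T (end_of (pos_ray c0)).
  move=> l; split; [exists (neg_ray c0) | exists (pos_ray c0)] => //.
    exact: neg_rayP.
  exact: pos_rayP.
have N c0 : is_line c0 -> end_of (neg_ray c0) <> end_of (pos_ray c0).
  move=> l /(end_of_eq (neg_rayP l) (pos_rayP l))/tails_sym; exact: line_ends_neq.
have [e1 e2] := E _ cc; have [e3 e4] := E _ cc'.
have [g [Gg h1 h2]] := G2 e1 e2 e3 e4 (N _ cc) (N _ cc').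
exists g => //; have gc := line_aut g cc; apply: (line_unique gc cc').
  by apply/(end_of_eq (pos_rayP gc) (pos_rayP cc')); rewrite -h2 end_act_of //; exact: pos_rayP.
by apply/(end_of_eq (neg_rayP gc) (neg_rayP cc')); rewrite -h1 end_act_of //; exact: neg_rayP.
Qed.

(** All lines being equivalent, every line is translated by every translation
length that occurs. *)
Lemma translate_line f x c : G f -> axial f x -> 0 < translation_len f -> is_line c ->
  exists2 g, G g & forall n, g (c n) = c (n + Posz (translation_len f))%R.
Proof.
move=> Gf ax lpos cc; have [|a [aa _ Ha]] := axis_ex ax; first by rewrite -(axial_len ax).
have [h Gh [j Hj]] := line_transport aa cc.
exists (h * f * h^-1)%g; first by do !apply: subgroupM => //; exact: subgroupV.
move=> n; have -> : c n = h (a (n - j)%R) by rewrite Hj subrK.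
by rewrite /= autK Ha Hj; congr c; lia.
Qed.

(** An element moving [c] to [c'] up to a shift by [k] acts on the common half
of the two lines as a translation by [k]; so, unless [k] is zero, every line is
translated by [k], and the shift can be undone along [c]. *)
Lemma half_line_transitive c c' : is_line c -> is_line c' ->
  (forall n, neg_ray c n = neg_ray c' n) -> exists2 g, G g & forall n, g (c n) = c' n.
Proof.
move=> cc cc' neg.
have negE (n : int) : (n <= 0)%R -> c n = c' n.
  by move=> n0; have := neg `|n|%N; rewrite /neg_ray; have -> : (- Posz `|n| = n)%R by lia.
have [g Gg [k Hk]] := line_transport cc cc'.
have key (f : aut T) (m : nat) : G f -> 0 < m ->
    (forall n : int, (n <= - Posz m)%R -> f (c n) = c (n + Posz m)%R) ->
    exists2 f', G f' & forall n, f' (c n) = c (n + Posz m)%R.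
  move=> Gf mpos H; pose x := c (- Posz (2 * m))%R.
  have fx : f x = c (- Posz m)%R by rewrite /x H; [congr c|]; lia.
  have f2x : f (f x) = c 0%R by rewrite fx H; [congr c|]; lia.
  have ax : axial f x by rewrite /axial f2x fx /x !cc; lia.
  have l : translation_len f = m by rewrite (axial_len ax) fx /x cc; lia.
  have [|f' Gf'] := translate_line Gf ax _ cc; first by rewrite l.
  by rewrite l; exists f'.
case: k Hk => [[|m]|m] Hk.
- by exists g => // n; rewrite Hk addr0.
- have [||f Gf Hf] := key g m.+1 Gg => // [n le|].
    by rewrite Hk -negE //; lia.
  exists (g * f^-1)%g; first by apply: subgroupM => //; exact: subgroupV.
  move=> n; have -> : c n = f (c (n - Posz m.+1)%R) by rewrite Hf subrK.
  by rewrite /= autK Hk subrK.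
have [||f Gf Hf] := key (g^-1)%g m.+1 (subgroupV Gg) => // [n le|].
  apply: (@aut_inj _ g); rewrite autVKg Hk negE; last by lia.
  by congr c'; lia.
exists (g * f)%g; first exact: subgroupM.
by move=> n; rewrite /= Hf Hk; congr c'; lia.
Qed.

(** Two lines through a vertex are exchanged half by half, by way of a third
half-line starting in a new direction. *)
Lemma line_transitive c c' : is_line c -> is_line c' -> c 0%R = c' 0%R ->
  exists2 g, G g & forall n, g (c n) = c' n.
Proof.
move=> cc cc' e0.
have trans c1 c2 c3 : (exists2 g, G g & forall n, g (c1 n) = c2 n) ->
    (exists2 g, G g & forall n, g (c2 n) = c3 n) -> exists2 g, G g & forall n, g (c1 n) = c3 n.
  move=> [g Gg Hg] [h Gh Hh]; exists (h * g)%g; first exact: subgroupM.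
  by move=> n; rewrite /= Hg.
have posT c1 c2 : is_line c1 -> is_line c2 -> pos_ray c1 = pos_ray c2 ->
    exists2 g, G g & forall n, g (c1 n) = c2 n.
  move=> l1 l2 e.
  have [n|g Gg Hg] := half_line_transitive (line_rev l1) (line_rev l2).
    by rewrite /neg_ray opprK; exact: (congr1 (fun f => f n) e).
  by exists g => // n; have := Hg (- n)%R; rewrite opprK.
have [t [vt tc tc']] := branch (c 0%R) (c (- 1)%R) (c' (- 1)%R).
have [r0 [rr0 r00 rr0d]] := ray_away branch (c 0%R) t.
have [r [rr r1 r2]] : exists r, [/\ is_ray r, r 0 = c 0%R & r 1 = t].
  have [n|r [rr ra rb]] := @prepend_ray _ (c 0%R) r0 1 rr0.
    by rewrite rr0d (dist_adj vt).
  by exists r; split=> //; rewrite -r00 -(rb 0).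
have [c1 [l1 p1 n1]] : exists c1, [/\ is_line c1, pos_ray c1 = r & neg_ray c1 = neg_ray c].
  apply: join_rays => //; [exact: neg_rayP|by rewrite r2].
have [c2 [l2 p2 n2]] : exists c1, [/\ is_line c1, pos_ray c1 = r & neg_ray c1 = neg_ray c'].
  by apply: join_rays => //; [exact: neg_rayP|rewrite r1 e0|rewrite r2].
apply: (trans _ c1); first by apply: half_line_transitive => // n; rewrite n1.
apply: (trans _ c2); first by apply: posT => //; rewrite p1 p2.
by apply: half_line_transitive => // n; rewrite n2.
Qed.

(** The composite of the flips of a line about two adjacent vertices. *)
Lemma even_translation c N : is_line c ->
  exists2 g, G g & forall n, g (c n) = c (n + Posz (2 * N))%R.
Proof.
move=> cc; elim: N => [|N [g Gg Hg]].
  by exists 1%g; [case: Ggrp | move=> n; congr c; lia].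
have [|g1 G1 H1] := line_transitive cc (line_rev cc); first by rewrite oppr0.
have [|g2 G2' H2] := line_transitive (line_shift 1%R cc) (line_shift (-1)%R (line_rev cc)).
  by congr c; lia.
exists (g2 * g1 * g)%g; first by do !apply: subgroupM.
move=> n; rewrite /= Hg H1.
have := H2 (- (n + Posz (2 * N)) - 1)%R; rewrite subrK => ->.
by congr c; lia.
Qed.

Lemma sphere_transitive v y z : d v y = d v z ->
  exists g, [/\ G g, g v = v & g y = z].
Proof.
move=> e; have [c [cc c0 cy]] := line_through branch v y.
have [c' [cc' c0' cz]] := line_through branch v z.
have [|g Gg Hg] := line_transitive cc cc'; first by rewrite c0.
exists g; split=> //; first by rewrite -[in LHS]c0 Hg.
by rewrite -cy Hg e.
Qed.

End Transitivity.

(** * Fixators of finite sets are compact and open *)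

Section Topology.
Variable T : tree.
Implicit Types (u v x y z w : T) (g h : aut T) (s : seq T).

Local Notation d := (@dist T).

Lemma cvg_aut (F : set_system (aut T)) (FF : Filter F) g :
  (forall u, F [set h : aut T | h u = g u]) -> F --> g.
Proof.
move=> H A; rewrite nbhsE => -[_ [[C Copen <-] Cg] sub].
rewrite nbhs_filterE; apply: filterS sub _.
have nC : nbhs (aut_ptws g) C by apply: open_nbhs_nbhs.
suff : (@aut_ptws T) @ F --> aut_ptws g by move/(_ _ nC).
apply/cvg_sup => u B; rewrite nbhsE => -[_ [[D Dopen <-] Dg] sub'].
apply: (@filterS _ F FF [set h : aut T | h u = g u]) (H u) => h hu; apply: sub'.
by move: Dg; rewrite /= /aut_ptws [g u](esym hu).
Qed.

Lemma open_stab u w : open [set g : aut T | g u = w].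
Proof.
rewrite openE => g /= gu; rewrite /interior.
have c : nbhs g --> g by [].
have ev : continuous (fun h : aut T => aut_ptws h u).
  move=> h; apply: (@continuous_comp (aut T) {ptws T -> discrete_topology T} (discrete_topology T) (@aut_ptws T) (fun f => f u)).
    exact: initial_continuous.
  exact: (@proj_continuous T (fun=> discrete_topology T) u).
have n1 : nbhs (aut_ptws g u) [set w : discrete_topology T] by rewrite nbhs_principalE /= -gu.
exact: (ev g _ n1).
Qed.


(** The filter generated by the fixators of finite sets converges to the
identity. *)
Lemma open_fixator (O : set (aut T)) : open O -> O 1%g ->
  exists s, forall g, (forall x, x \in s -> g x = x) -> O g.
Proof.
move=> Oopen O1.
pose F : set_system (aut T) :=
  [set A | exists s, forall g, (forall x, x \in s -> g x = x) -> A g].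
have FF : Filter F.
  split; first by exists [::].
    move=> A B [s Hs] [t Ht]; exists (s ++ t) => g H; split.
      by apply: Hs => x xs; apply: H; rewrite mem_cat xs.
    by apply: Ht => x xs; apply: H; rewrite mem_cat xs orbT.
  by move=> A B sub [s Hs]; exists s => g /Hs /sub.
have cv : F --> (1%g : aut T).
  by apply: cvg_aut => u; exists [:: u] => g; apply; rewrite inE.
by apply: (cv O); apply: open_nbhs_nbhs; split.
Qed.

Lemma ultra_mem (F : set_system (aut T)) (FU : UltraFilter F) (f : aut T -> T) s :
  F [set g | f g \in s] -> exists w, F [set g | f g = w].
Proof.
elim: s => [F0|w s IH Fs]; first by have [g] := filter_ex F0.
have [Fw|] := in_ultra_setVsetC [set g | f g = w] FU; first by exists w.
move=> Fn; apply: IH; apply: filterS (filterI Fs Fn) => g [] /=.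
by rewrite inE => /predU1P[].
Qed.

Hypothesis fin : locally_finite T.

Definition nbr_seq v : seq T := enum_fset (fset_set (nbrs v)).

Lemma mem_nbr_seq v x : (x \in nbr_seq v) = adj v x.
Proof.
have -> : (x \in nbr_seq v) = (x \in fset_set (nbrs v)) by [].
rewrite in_fset_set //; apply/idP/idP => [|vx]; first by rewrite inE.
by rewrite inE.
Qed.

Lemma nbr_seq_uniq v : uniq (nbr_seq v).
Proof. exact: fset_uniq. Qed.

Lemma size_nbr_seq v : size (nbr_seq v) = valency v.
Proof. by []. Qed.

Lemma sphere_finite v n : exists s, forall x, d v x = n -> x \in s.
Proof.
elim: n => [|n [s Hs]].
  by exists [:: v] => x /dist_eq0 ->; rewrite inE.
exists (flatten (map nbr_seq s)) => x vx; apply/flatten_mapP.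
have [y xy yv] : exists2 y, adj x y & d y v = n by apply: dist_step; rewrite dist_sym.
by exists y; [apply: Hs; rewrite dist_sym | rewrite mem_nbr_seq adj_sym].
Qed.

Variable G : set (aut T).
Hypothesis Ggrp : is_subgroup G.
Hypothesis Gclosed : closed G.

Definition fixator s : set (aut T) := [set g | G g /\ forall x, x \in s -> g x = x].

Lemma fixator_subgroup s : is_subgroup (fixator s).
Proof.
have [G1 GM GV] := Ggrp; split; first by split.
  move=> g h [Gg Hg] [Gh Hh]; split; first exact: GM.
  by move=> x xs; rewrite /= Hh // Hg.
by move=> g [Gg Hg]; split=> [|x xs]; [exact: GV | rewrite -{1}(Hg x xs) autKg].
Qed.

(** Along an ultrafilter in a vertex stabilizer the image of each vertex is
eventually constant, as it ranges over a finite sphere; the limits of the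
images under [g] and [g^-1] form an automorphism. *)
Lemma fixator_compact x0 s : compact (fixator (x0 :: s)).
Proof.
rewrite compact_ultra => F FU FV; have FF : Filter F by apply: filter_filter.
have [_ _ V_inv] := fixator_subgroup (x0 :: s).
have lim (f : aut T -> T) u : (forall g, fixator (x0 :: s) g -> d x0 (f g) = d x0 u) ->
    exists w, F [set g | f g = w].
  move=> H; have [t Ht] := sphere_finite x0 (d x0 u).
  apply: (@ultra_mem F FU f t).
  have sub : fixator (x0 :: s) `<=` [set g | f g \in t].
    by move=> g Vg; exact: Ht (H g Vg).
  exact: filterS sub FV.
have fix0 g u : fixator (x0 :: s) g -> d x0 (g u) = d x0 u.
  by move=> [_ H]; rewrite -{1}(H x0) ?inE ?eqxx // dist_aut.
have [f Hf] := choice (fun u => lim (fun g => g u) u (fun g Vg => fix0 g u Vg)).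
have [f' Hf'] := choice (fun u => lim (fun g => (g^-1)%g u) u
  (fun g Vg => fix0 (g^-1)%g u (V_inv g Vg))).
have fK : cancel f f'.
  move=> u; have [g [g1 g2]] := filter_ex (filterI (Hf u) (Hf' (f u))).
  by rewrite -g2 -g1 autKg.
have f'K : cancel f' f.
  move=> u; have [g [g1 g2]] := filter_ex (filterI (Hf (f' u)) (Hf' u)).
  by rewrite -g1 -g2 autVKg.
have fadj u v : adj (f u) (f v) = adj u v.
  have [g [<- <-]] := filter_ex (filterI (Hf u) (Hf v)); exact: aut_adj.
pose a : aut T := Aut fK f'K fadj.
have cv : F --> a by exact: cvg_aut.
exists a; split=> //; split.
  apply: Gclosed => B /cv FB.
  by have [g [[Gg _] Bg]] := filter_ex (filterI FV FB); exists g.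
move=> x xs; have [g [[_ Hg] e]] := filter_ex (filterI FV (Hf x)).
by rewrite -[RHS](Hg x xs); exact: esym e.
Qed.

Lemma fixator_open s : exists2 O, open O & fixator s = G `&` O.
Proof.
exists [set g : aut T | forall x, x \in s -> g x = x] => //.
elim: s => [|x s IH].
  have e : [set g : aut T | forall x, x \in [::] -> g x = x] = setT.
    by apply/seteqP; split.
  by rewrite e; exact: openT.
have -> : [set g : aut T | forall y, y \in x :: s -> g y = y] =
    [set g | g x = x] `&` [set g | forall y, y \in s -> g y = y].
  apply/seteqP; split=> g /= => [H|[gx H] y].
    by split=> [|y ys]; apply: H; rewrite inE ?eqxx ?ys ?orbT.
  by rewrite inE => /predU1P[->|/H].
by apply: openI => //; exact: open_stab.
Qed.

Lemma fixator_compact_open x0 s : compact_open_subgroup G (fixator (x0 :: s)).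
Proof.
split; [exact: fixator_subgroup | exact: fixator_compact | exact: fixator_open].
Qed.

(** If the orbit were infinite, the sets of elements moving [x] outside a given
finite set would generate a filter without cluster point. *)
Lemma compact_orbit V x : compact V -> exists s, forall g : aut T, V g -> g x \in s.
Proof.
move=> Vcpt; apply: contrapT => no.
pose F : set_system (aut T) :=
  [set A | exists s, forall g : aut T, V g -> g x \notin s -> A g].
have FF : ProperFilter F.
  split.
    by move=> [s Hs]; apply: no; exists s => g Vg; apply/negPn/negP => /(Hs g Vg).
  split; first by exists [::].
    move=> A B [s Hs] [t Ht]; exists (s ++ t) => g Vg.
    by rewrite mem_cat negb_or => /andP[gs gt]; split; [exact: Hs | exact: Ht].
  by move=> A B sub [s Hs]; exists s => g Vg gs; apply: sub; exact: Hs.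
have [|p [Vp clp]] := Vcpt F FF; first by exists [::].
have FA : F [set g | V g /\ g x <> p x].
  by exists [:: p x] => g Vg; rewrite inE => /eqP.
have pA : nbhs p [set g : aut T | g x = p x].
  by apply: open_nbhs_nbhs; split=> //; exact: open_stab.
by have [g [[_ +] gp]] := clp _ _ FA pA.
Qed.

Lemma finite_values (P : aut T -> Prop) s :
  (forall y, exists t : seq T, forall g, P g -> g y \in t) ->
  exists bs : seq (aut T), forall g, P g ->
    exists2 b, b \in bs & P b /\ forall y, y \in s -> b y = g y.
Proof.
elim: s P => [|y s IH] P HP.
  have [[g0 Pg0]|no] := pselect (exists g, P g); last first.
    by exists [::] => g Pg; case: no; exists g.
  by exists [:: g0] => g _; exists g0; rewrite ?inE.
have [t Ht] := HP y.
have /choice[f Hf] z : exists bs : seq (aut T), forall g, P g /\ g y = z ->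
    exists2 b, b \in bs & (P b /\ b y = z) /\ forall x, x \in s -> b x = g x.
  apply: IH => x; have [t' Ht'] := HP x.
  by exists t' => g [Pg _]; exact: Ht'.
exists (flatten (map f t)) => g Pg.
have [b bf [[Pb by_] Hb]] := Hf (g y) g (conj Pg erefl).
exists b; first by apply/flatten_mapP; exists (g y) => //; exact: Ht.
by split=> // x; rewrite inE => /predU1P[->|]; [|exact: Hb].
Qed.

(** The subgroup contains the fixator of a finite set in [G], and the elements
of the stabilizer of [x] take finitely many values on that set. *)
Lemma stabilizer_cosets V x : compact_open_subgroup G V ->
  exists bs : seq (aut T), forall g, G g -> g x = x ->
    exists2 b, b \in bs & V (b^-1 * g)%g.
Proof.
have [_ GM GV] := Ggrp.
move=> [[V1 _ _] _ [O Oopen VE]].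
have [|s Hs] := @open_fixator O Oopen; first by move: V1; rewrite VE => -[].
have [y|bs Hbs] := @finite_values (fun g => G g /\ g x = x) s.
  have [t Ht] := sphere_finite x (d x y); exists t => g [_ gx]; apply: Ht.
  by rewrite -{1}gx dist_aut.
exists bs => g Gg gx; have [b bbs [[Gb bx] Hb]] := Hbs g (conj Gg gx).
exists b => //; rewrite VE; split; first by apply: GM => //; exact: GV.
by apply: Hs => z zs; rewrite /= -Hb //; exact: autK.
Qed.

End Topology.

(** * The scale function *)

Section Indices.
Variable T : tree.
Implicit Types (H K V : set (aut T)).

Lemma has_index_transversal H K m : has_index H K m -> K 1%g ->
  exists hs : seq (aut T), size hs = m /\
    forall h, H h -> exists2 h', h' \in hs & exists2 k, K k & h = (h' * k)%g.
Proof.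
rewrite /has_index card_eq_sym => /card_set_bijP[f [fC _ fsurj]] K1.
have /choice[rep Hrep] i : exists h, i < m -> f i = [set (h * y)%g | y in K].
  have [lt|_] := ltnP i m; last by exists 1%g.
  by have [h _ <-] := fC i lt; exists h.
exists (map rep (iota 0 m)); rewrite size_map size_iota; split=> // h Hh.
have [i /= lt e] := fsurj _ (ex_intro2 _ _ h Hh erefl).
exists (rep i); first by apply: map_f; rewrite mem_iota.
have : [set (h * y)%g | y in K] h by exists 1%g; rewrite ?mulg1.
by rewrite -e (Hrep i lt) => -[k Kk <-]; exists k.
Qed.

Lemma has_index_pos H K : H 1%g -> ~ has_index H K 0.
Proof.
move=> H1; rewrite /has_index II0 card_eq0 => /eqP /seteqP[+ _].
by move=> /(_ [set (1 * y)%g | y in K]); apply; exists 1%g.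
Qed.

Lemma has_index_le H K (hs : seq (aut T)) :
  (forall h, H h -> exists2 h', h' \in hs &
     [set (h * y)%g | y in K] = [set (h' * y)%g | y in K]) ->
  exists2 m, m <= size hs & has_index H K m.
Proof.
move=> cov; rewrite /has_index; set C := [set _ | _ in H].
pose f i := [set (nth 1%g hs i * y)%g | y in K].
have sub : C `<=` f @` `I_(size hs).
  move=> _ [h Hh <-]; have [h' h'hs ->] := cov h Hh.
  by exists (index h' hs) => /=; [rewrite index_mem | rewrite /f nth_index].
have le : (C #<= `I_(size hs))%card.
  exact: card_le_trans (subset_card_le sub) (card_image_le _ _).
have [m Cm] : exists m, (C #= `I_m)%card.
  by apply/finite_setP; apply: sub_finite_set sub _; exact: finite_image.
by exists m => //; rewrite -card_le_II -(card_le_eql Cm).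
Qed.

End Indices.

(** Otherwise [(P / m) ^ n] would outgrow every constant, by Bernoulli's
inequality. *)
Lemma growth_le P m C : (forall n, P ^ n <= C * m ^ n) -> P <= m.
Proof.
move=> H; rewrite leqNgt; apply/negP => lt.
have [m0|mpos] := posnP m.
  by have := H 1; rewrite m0 muln0; lia.
have bern n : m ^ n * (m + n) <= m * m.+1 ^ n.
  elim: n => [|n IH]; first by rewrite !expn0; lia.
  rewrite !expnS; nia.
have := bern (C * m); have := H (C * m).
have Cpos : 0 < C by have := H 0; rewrite !expn0; lia.
have : m.+1 ^ (C * m) <= P ^ (C * m) by rewrite leq_exp2r // muln_gt0 Cpos.
have : 0 < m ^ (C * m) by rewrite expn_gt0 mpos.
move: (m ^ _) (m.+1 ^ _) (P ^ _) => a b p apos bp pa ab.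
have := leq_mul (leqnn m) (leq_trans bp pa).
have : 0 < a * m by rewrite muln_gt0 apos.
nia.
Qed.

Section Scale.
Variable T : tree.
Implicit Types (u v x y z w : T) (g h : aut T) (c : int -> T) (s : seq T).

Local Notation d := (@dist T).

Hypothesis fin : locally_finite T.
Hypothesis semi : semi_homogeneous T.

(** The number of continuations of a path arriving at [v]. *)
Definition branches v := (valency v).-1.

Lemma branches_even v w : ~~ odd (d v w) -> branches v = branches w.
Proof. by move=> e; rewrite /branches (semi e). Qed.

Lemma branches_aut g v : branches (g v) = branches v.
Proof.
rewrite /branches -!size_nbr_seq; congr _.-1.
rewrite -(size_map g (nbr_seq v)); apply: perm_size; apply: uniq_perm.
- exact: nbr_seq_uniq.
- by rewrite map_inj_uniq ?nbr_seq_uniq //; exact: aut_inj.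
move=> x; rewrite mem_nbr_seq //; apply/idP/mapP => [gx|[y + ->]].
  by exists ((g^-1)%g x); rewrite ?autVKg // mem_nbr_seq // -(aut_adj g) autVKg.
by rewrite mem_nbr_seq // aut_adj.
Qed.

(** By semi-homogeneity the branching numbers alternate; [uphalf n] of the [n]
steps start at even distance from [v]. *)
Definition descendants_number v u n := branches v ^ uphalf n * branches u ^ n./2.

(** Away from [u] the vertices at distance [n] from its neighbour [v] multiply by
the branching number at each step, which alternates. *)
Lemma descendants v u n : adj v u -> exists s, [/\ uniq s,
  size s = descendants_number v u n &
  forall y, (y \in s) = (d v y == n) && (d u y == n.+1)].
Proof.
move=> vu; have vu1 := dist_adj vu; elim: n => [|n [s [us ss sP]]].
  exists [:: v]; split=> // y; rewrite inE.
  apply/eqP/andP => [->|[/eqP/dist_eq0 -> //]].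
  by rewrite distxx dist_sym vu1.
pose far y z := d u z == n.+2.
pose ch y := seq.filter (far y) (nbr_seq y).
have chsize y : y \in s -> size (ch y) = branches y.
  rewrite sP => /andP[/eqP vy /eqP uy].
  have [p yp pu] : exists2 p, adj y p & d p u = n by apply: dist_step; rewrite dist_sym.
  have e : seq.filter (predC (far y)) (nbr_seq y) =i [:: p].
    move=> z; rewrite mem_filter mem_nbr_seq // mem_seq1 /= /far.
    apply/andP/eqP => [[/eqP nf yz]|->]; last by rewrite dist_sym pu; split=> //; lia.
    apply: (@closer_neighbour_unique _ u y) => //; last by dlia.
    by case: (dist_adj_cases u yz) => uz; [case: nf; rewrite uz uy | lia].
  have /perm_size := uniq_perm (filter_uniq _ (nbr_seq_uniq y)) (isT : uniq [:: p]) e.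
  have := count_predC (far y) (nbr_seq y).
  by rewrite /branches -size_nbr_seq /ch !size_filter /=; lia.
exists [seq z | y <- s, z <- ch y]; split.
- apply: allpairs_uniq_dep => //.
    by move=> y _; apply: filter_uniq; exact: nbr_seq_uniq.
  move=> [y1 z1] [y2 z2] /allpairsPdep[y [z [ys zch [-> ->]]]].
  move=> /allpairsPdep[y' [z' [ys' zch' [-> ->]]]] /= e.
  rewrite -e in zch' *.
  move: ys ys' zch zch'; rewrite !sP !mem_filter !mem_nbr_seq // /far.
  move=> /andP[/eqP a1 /eqP a2] /andP[/eqP b1 /eqP b2] /andP[/eqP c1 c2] /andP[_ c3].
  suff -> : y = y' by [].
  by apply: (@closer_neighbour_unique _ u z); rewrite 1?adj_sym // c1; lia.
- rewrite size_allpairs_dep.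
  have /all_pred1P -> : all (pred1 (if odd n then branches u else branches v))
      [seq size (ch y) | y <- s].
    apply/allP => _ /mapP[y ys ->] /=; rewrite chsize //.
    move: ys; rewrite sP => /andP[/eqP vy /eqP uy].
    by apply/eqP; case: ifP => on; apply: branches_even; rewrite dist_sym ?vy ?uy /= ?on.
  rewrite size_map.
  rewrite sumn_nseq ss /descendants_number.
  rewrite !uphalf_half /= uphalf_half.
  by case: (odd n) => /=; rewrite ?add0n ?add1n ?addn0 ?expnS; lia.
move=> z; apply/allpairsPdep/andP => [[y [z' [ys zch ->]]]|[/eqP vz /eqP uz]].
  move: ys zch; rewrite sP mem_filter mem_nbr_seq // /far.
  move=> /andP[/eqP vy /eqP uy] /andP[/eqP uz yz]; rewrite uz eqxx; split=> //.
  by case: (dist_adj_cases v yz); have := dist_triangle u v z'; dlia.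
have [y zy yv] : exists2 y, adj z y & d y v = n by apply: dist_step; rewrite dist_sym.
exists y, z; split=> //; last by rewrite mem_filter mem_nbr_seq // adj_sym zy /far uz eqxx.
rewrite sP; have := dist_triangle u v y; have := dist_triangle u y z.
by have := dist_adj zy => ? ? ?; apply/andP; split; apply/eqP; dlia.
Qed.

(** Squaring makes the factor of a step independent of its parity. *)
Lemma descendants_sq v u n : (odd n -> branches v = branches u) ->
  descendants_number v u n ^ 2 = (branches v * branches u) ^ n.
Proof.
rewrite /descendants_number uphalf_half expnMn -!expnM !muln2 doubleD.
have := odd_double_half n; case: (odd n) => /= en; last first.
  by rewrite add0n in en; rewrite !add0n en expnMn.
move=> /(_ isT) <-; rewrite -expnD -[X in _ = _ ^ X]en expnMn -expnD; congr (_ ^ _); lia.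
Qed.

End Scale.

Section ScaleFormula.
Variable T : tree.
Implicit Types (u v x y z w : T) (g h : aut T) (c : int -> T) (s : seq T).

Local Notation d := (@dist T).

Hypothesis fin : locally_finite T.
Hypothesis semi : semi_homogeneous T.
Hypothesis val3 : forall v : T, 3 <= valency v.
Variable G : set (aut T).
Hypothesis Ggrp : is_subgroup G.
Hypothesis Gclosed : closed G.
Hypothesis G2 : two_transitive_on_ends G.

Let branch : branching T := valency_branching fin val3.

Lemma conj_subgroup g V : is_subgroup V -> is_subgroup (conj_set g V).
Proof.
move=> [V1 VM VV]; split; first by exists 1%g; rewrite // mulg1 mulgV.
  move=> _ _ [a Va <-] [b Vb <-]; exists (a * b)%g; first exact: VM.
  by rewrite !mulgA mulgVK.
by move=> _ [a Va <-]; exists (a^-1)%g; [exact: VV | rewrite !invgM invgK mulgA].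
Qed.

Lemma coset_eq (K : set (aut T)) g h : is_subgroup K -> K (h^-1 * g)%g ->
  [set (g * y)%g | y in K] = [set (h * y)%g | y in K].
Proof.
move=> [K1 KM KV] Kgh; apply/seteqP; split=> _ [y Ky <-].
  by exists ((h^-1 * g) * y)%g; [exact: KM | rewrite mulgA mulgA mulgV mul1g].
exists ((h^-1 * g)^-1 * y)%g; first by apply: KM => //; exact: KV.
by rewrite invgM invgK !mulgA mulgV mul1g.
Qed.

Lemma setI_subgroup (H K : set (aut T)) : is_subgroup H -> is_subgroup K ->
  is_subgroup (H `&` K).
Proof.
move=> [H1 HM HV] [K1 KM KV]; split; first by split.
  by move=> g h [? ?] [? ?]; split; [exact: HM | exact: KM].
by move=> g [? ?]; split; [exact: HV | exact: KV].
Qed.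

Lemma scale_attained g V n : compact_open_subgroup G V ->
  has_index (conj_set g V) (conj_set g V `&` V) n ->
  scale G g <= n /\ exists2 W, compact_open_subgroup G W &
    has_index (conj_set g W) (conj_set g W `&` W) (scale G g).
Proof.
move=> Vco Vn; rewrite /scale; set A := (X in nat_min X).
by have /nat_minP[[W Wco Wn] mn] : A !=set0; [exists n, V | split; [apply: mn; exists V | exists W]].
Qed.

(** The fixator of a fixed vertex, or of the two ends of an inverted edge, is
normalized by [g]. *)
Lemma scale_elliptic g : G g -> elliptic g -> scale G g = 1.
Proof.
move=> Gg ell.
have [x0 [s [gs gVs]]] : exists x0 s,
    (forall x, x \in x0 :: s -> g x \in x0 :: s) /\
    (forall x, x \in x0 :: s -> (g^-1)%g x \in x0 :: s).
  case: ell => [[v gv]|[u [v [_ gu gv]]]].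
    have gVv : (g^-1)%g v = v by rewrite -{1}gv autKg.
    by exists v, [::]; split=> x; rewrite !inE => /eqP ->; rewrite ?gVv ?gv.
  have gVu : (g^-1)%g u = v by rewrite -gv autKg.
  have gVv : (g^-1)%g v = u by rewrite -gu autKg.
  exists u, [:: v]; split=> x; rewrite !inE => /orP[] /eqP ->;
    by rewrite ?gu ?gv ?gVu ?gVv eqxx ?orbT.
have [_ GM GV] := Ggrp.
set V := fixator G (x0 :: s).
have Vco : compact_open_subgroup G V by exact: fixator_compact_open.
have Vgrp : is_subgroup V by exact: fixator_subgroup.
have conjV f : G f -> (forall x, x \in x0 :: s -> (f^-1)%g x \in x0 :: s) ->
    conj_set f V `<=` V.
  move=> Gf H _ [y [Gy Hy] <-]; split.
    by apply: (GM); [exact: GM | exact: GV].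
  by move=> x xs; have := Hy _ (H x xs) => /= e; rewrite e; exact: autVK.
have conjE : conj_set g V = V.
  apply/seteqP; split; first exact: conjV.
  move=> y Vy; exists (g^-1 * y * g)%g; last first.
    by rewrite !mulgA mulgV mul1g -mulgA mulgV mulg1.
  have sub := conjV (g^-1)%g (GV _ Gg); rewrite invgK in sub.
  by apply: sub => //; exists y; rewrite // invgK.
have [m m1 Hm] : exists2 m, m <= 1 & has_index (conj_set g V) (conj_set g V `&` V) m.
  rewrite conjE setIid; apply: (@has_index_le _ _ _ [:: 1%g]) => h Vh.
  exists 1%g; first by rewrite inE.
  by apply: coset_eq => //; rewrite invg1 mul1g.
have [le [W [Wgrp _ _] HW]] := scale_attained Vco Hm.
have W1 : conj_set g W 1%g by case: (conj_subgroup g Wgrp).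
case: (scale G g) le HW => [_ /(has_index_pos W1)//|[|n] le _] //; lia.
Qed.

(** For the fixator of an edge of the axis the cosets to be counted are
determined by the image of [c 0], which descends from the translated edge. *)
Lemma scale_hyperbolic_le g c (k : nat) : G g -> is_line c -> 0 < k ->
  (forall n, g (c n) = c (n + Posz k)%R) ->
  exists V n, [/\ compact_open_subgroup G V,
    n <= descendants_number (c (Posz k)) (c (Posz k.+1)) k &
    has_index (conj_set g V) (conj_set g V `&` V) n].
Proof.
move=> Gg cc kpos gc; have [_ GM GV] := Ggrp.
set V := fixator G [:: c 0%R; c 1%R]; exists V.
have Vco : compact_open_subgroup G V by exact: fixator_compact_open.
have Vgrp : is_subgroup V by exact: fixator_subgroup.
have ck : adj (c (Posz k)) (c (Posz k.+1)) by apply: dist1_adj; rewrite cc; lia.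
have [s [us <- sP]] := descendants fin semi k ck.
set H := conj_set g V; set K := H `&` V.
have Hgrp : is_subgroup H by exact: conj_subgroup.
have Kgrp : is_subgroup K by exact: setI_subgroup.
have Hfix h : H h -> [/\ G h, h (c (Posz k)) = c (Posz k) & h (c (Posz k.+1)) = c (Posz k.+1)].
  move=> [y [Gy Hy] <-]; have y0 := Hy (c 0%R); have y1 := Hy (c 1%R).
  rewrite !inE !eqxx orbT in y0 y1; have {}y0 := y0 isT; have {}y1 := y1 isT.
  split; first by apply: (GM); [exact: GM | exact: GV].
    have -> : c (Posz k) = g (c 0%R) by rewrite gc add0r.
    by rewrite /= autK y0.
  have -> : c (Posz k.+1) = g (c 1%R) by rewrite gc; congr c; lia.
  by rewrite /= autK y1.
have /choice[rep Hrep] z : exists h, (exists2 h', H h' & h' (c 0%R) = z) -> H h /\ h (c 0%R) = z.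
  have [[h Hh hz]|no] := pselect (exists2 h', H h' & h' (c 0%R) = z).
    by exists h.
  by exists 1%g.
have [h Hh|n le Hn] := @has_index_le _ H K (map rep s); last first.
  by exists n; rewrite size_map in le.
have [Gh hk hk1] := Hfix h Hh.
have [Hr r0] := Hrep (h (c 0%R)) (ex_intro2 _ _ h Hh erefl).
exists (rep (h (c 0%R))).
  apply: map_f; rewrite sP -{1}hk -{1}hk1 !dist_aut !cc; apply/andP; split; apply/eqP; lia.
apply: coset_eq => //; set r := rep _ in Hr r0 *.
have Hrh : H (r^-1 * h)%g by case: Hgrp => _ HM HV; apply: HM => //; exact: HV.
split=> //; have [Grh rhk _] := Hfix _ Hrh; split=> //.
have rh0 : (r^-1 * h)%g (c 0%R) = c 0%R by rewrite /= -r0 autK.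
move=> y; rewrite !inE => /orP[] /eqP -> //.
apply: (@between_unique _ (c 0%R) (c (Posz k))).
- by rewrite -{2}rh0 -{2}rhk !dist_aut !cc; lia.
- by rewrite !cc; lia.
by rewrite -{1}rh0 dist_aut.
Qed.

(** Every compact open subgroup [V] is commensurable with the stabilizer of [c 0],
whose orbits grow like the descendants, while an index [m] lets [V] move
[g^-n (c 0)] to at most constantly many times [m ^ n] vertices. *)
Lemma scale_hyperbolic_ge g c (k : nat) V m : G g -> is_line c -> 0 < k ->
  (forall n, g (c n) = c (n + Posz k)%R) -> compact_open_subgroup G V ->
  has_index (conj_set g V) (conj_set g V `&` V) m ->
  descendants_number (c 0%R) (c 1%R) k <= m.
Proof.
move=> Gg cc kpos gc Vco Hm.
have [Vgrp Vcpt _] := Vco; have [V1 VM _] := Vgrp.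
have [|hs [hsm Hhs]] := has_index_transversal Hm.
  by split=> //; case: (conj_subgroup g Vgrp).
(* The cosets of [V] by [as_] cover [V g^-1], so the set of images of [c 0] grows
   at most [m]-fold with each application of [g^-1]. *)
pose as_ := [seq (g^-1 * h)%g | h <- hs].
have asP (y : aut T) : V y -> exists a y' : aut T, [/\ a \in as_, V y' & (y * g^-1 = a * y')%g].
  move=> Vy; have [|h' h'hs [y' [_ Vy'] e]] := Hhs (g * y * g^-1)%g; first by exists y.
  exists (g^-1 * h')%g, y'; split=> //; first exact: map_f.
  by rewrite -mulgA -e !mulgA mulVg mul1g.
have [p0 Hp0] := compact_orbit (c 0%R) Vcpt.
have L n : exists l : seq T, size l <= size p0 * m ^ n /\
    forall y : aut T, V y -> y (iter n (g^-1)%g (c 0%R)) \in l.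
  elim: n => [|n [l [sl Hl]]]; first by exists p0; rewrite muln1.
  exists [seq (a : aut T) z | a <- as_, z <- l]; split.
    rewrite size_allpairs size_map hsm expnS mulnCA leq_mul2l sl orbT //.
  move=> y Vy; have [a [y' [aas Vy' e]]] := asP y Vy.
  have -> : y (iter n.+1 (g^-1)%g (c 0%R)) = a (y' (iter n (g^-1)%g (c 0%R))).
    exact: (congr1 (fun f : aut T => f (iter n (g^-1)%g (c 0%R))) e).
  by apply: allpairs_f => //; exact: Hl.
have [bs Hbs] := stabilizer_cosets fin Ggrp (c 0%R) Vco.
have par : odd k -> branches (c 0%R) = branches (c 1%R).
  move=> ok; have -> : branches (c 0%R) = branches (c (Posz k)).
    by rewrite -(branches_aut fin g) gc add0r.
  by apply: branches_even => //; rewrite cc; lia.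
apply: (@growth_le _ _ (size bs * size p0)) => n.
have -> : descendants_number (c 0%R) (c 1%R) k ^ n = descendants_number (c 0%R) (c 1%R) (n * k).
  apply/eqP; rewrite -(@eqn_exp2r _ _ 2) // -expnM mulnC expnM.
  by rewrite !descendants_sq // ?oddM -?expnM ?(mulnC n) // => /andP[].
have c01 : adj (c 0%R) (c 1%R) by apply: dist1_adj; rewrite cc.
have [s [us <- sP]] := descendants fin semi (n * k) c01.
have [l [sl Hl]] := L n.
apply: (@leq_trans (size [seq (b : aut T) z | b <- bs, z <- l])); last first.
  by rewrite size_allpairs -mulnA leq_mul2l sl orbT.
apply: uniq_leq_size => // y; rewrite sP => /andP[/eqP cy _].
have it : iter n (g^-1)%g (c 0%R) = c (- Posz (n * k))%R.
  have H j : (g^-1)%g (c j) = c (j + - Posz k)%R.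
    by apply: (@aut_inj _ g); rewrite autVKg gc; congr c; lia.
  by rewrite (iter_line _ _ H); congr c; lia.
have [|f [Gf f0 fy]] := @sphere_transitive T G Ggrp G2 branch (c 0%R) (c (- Posz (n * k))%R) y.
  by rewrite cc cy; lia.
have [b bbs Vb] := Hbs f Gf f0.
have := Hl _ Vb; rewrite it => /(allpairs_f (fun (b : aut T) z => b z) bbs).
by rewrite /= fy autVK.
Qed.

(** In two steps the descendants multiply by a number independent of the place,
so the square of the scale depends on the translation length alone. *)
Lemma scale_sq : exists2 N, 1 < N & forall g, G g -> scale G g ^ 2 = N ^ translation_len g.
Proof.
have [v0] := tree_inhabited T.
have [w0 [v0w0 _ _]] := branch v0 v0 v0.
have br2 v : 2 <= branches v by rewrite /branches; have := val3 v; lia.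
exists (branches v0 * branches w0); first by have := br2 v0; have := br2 w0; nia.
move=> g Gg; have [ell|hyp] := pselect (elliptic g).
  by rewrite scale_elliptic //; move/elliptic_len: ell => ->.
have [x ax] := hyperbolic_axial hyp.
have lpos : 0 < translation_len g by apply/hyperbolic_len.
have [|c [cc c0 gc]] := axis_ex ax; first by rewrite -(axial_len ax).
set k := translation_len g in lpos gc *.
have [V [n [Vco len Hn]]] := scale_hyperbolic_le Gg cc lpos gc.
have [le [W Wco HW]] := scale_attained Vco Hn.
have ge := scale_hyperbolic_ge Gg cc lpos gc Wco HW.
have bk : branches (c (Posz k)) = branches (c 0%R).
  by rewrite -(branches_aut fin g (c 0%R)) gc add0r.
have bk1 : branches (c (Posz k.+1)) = branches (c 1%R).
  by rewrite -(branches_aut fin g (c 1%R)) gc; congr (branches (c _)); lia.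
have {ge} -> : scale G g = descendants_number (c 0%R) (c 1%R) k.
  apply/eqP; rewrite eqn_leq ge andbT (leq_trans le) // (leq_trans len) //.
  by rewrite /descendants_number bk bk1.
rewrite descendants_sq //; last first.
  by move=> ok; rewrite -bk; apply: branches_even => //; rewrite cc; lia.
congr (_ ^ _); have c01 : adj (c 0%R) (c 1%R) by apply: dist1_adj; rewrite cc.
have [ev|od] := boolP (odd (d (c 0%R) v0)); last first.
  rewrite (branches_even semi od); congr (_ * _); apply: branches_even => //.
  have := dist_adj_cases (c 1%R) v0w0; have := dist_adj_cases v0 c01.
  by dlia.
rewrite mulnC; congr (_ * _); apply: branches_even => //.
  by have := dist_adj_cases v0 c01; dlia.
by have := dist_adj_cases (c 0%R) v0w0; dlia.
Qed.

Lemma s_multiplicativeP (S : set (aut T)) :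
  s_multiplicative G S <-> length_additive G S.
Proof.
have [N N1 HN] := scale_sq; have [_ GM _] := Ggrp.
have E (x y : aut T) : G x -> G y -> scale G (x * y)%g = scale G x * scale G y <->
    translation_len (x * y)%g = translation_len x + translation_len y.
  move=> Gx Gy; split=> e.
    apply: (@expnI N) => //.
    by rewrite expnD -!HN // ?e ?expnMn //; exact: GM.
  apply/eqP; rewrite -(@eqn_exp2r _ _ 2) // expnMn !HN // ?e ?expnD //; exact: GM.
by split=> -[SG SM Sm]; split=> // x y Sx Sy; apply/(E x y (SG _ Sx) (SG _ Sy)); exact: Sm.
Qed.

End ScaleFormula.

(** * The geometric realization and the standard semigroups *)

Section Points.
Variables (R : realType) (T : tree).
Implicit Types (u v x y z w : T) (g h : aut T).

Local Notation d := (@dist T).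

Lemma vertex_pointE v w : vertex_point R v w = ((w == v)%:R)%R :> R.
Proof. by rewrite /vertex_point /bary subr0 mul1r mul0r addr0. Qed.

Lemma point_act_bary g u v (t : R) : point_act g (bary u v t) = bary (g u) (g v) t.
Proof.
apply/funext => w; rewrite /point_act /bary /=.
have E x : (aut_inv g w == x) = (w == g x).
  by apply/eqP/eqP => [<-|->]; rewrite ?autVK ?autK.
by rewrite !E.
Qed.

Lemma point_act_vertex g v : point_act g (vertex_point R v) = vertex_point R (g v).
Proof. exact: point_act_bary. Qed.

Lemma point_dist_vertex x y : point_dist (vertex_point R x) (vertex_point R y) = ((d x y)%:R)%R.
Proof.
rewrite /point_dist; set A := (X in inf X).
suff -> : A = [set ((d x y)%:R)%R] by exact: inf1.
have pos u w : (0 < vertex_point R u w)%R -> w = u.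
  by rewrite vertex_pointE; case: eqP => //=; rewrite ltxx.
have self u : vertex_point R u u = 1%R by rewrite vertex_pointE eqxx.
apply/seteqP; split=> [_ [[u [v [uv px py ->]]]|[u [v [/pos -> /pos -> ->]]]]|_ ->] /=.
- have {}px : x = u \/ x = v by apply: px; rewrite /= self oner_neq0.
  have {}py : y = u \/ y = v by apply: py; rewrite /= self oner_neq0.
  have vu : (u == v) = false by apply/eqP => e; move: uv; rewrite e adj_irr.
  have vu' : (v == u) = false by rewrite eq_sym.
  have e := dist_adj uv; have e' := dist_sym v u.
  case: px py => -> [] ->; rewrite !vertex_pointE ?eqxx ?vu ?vu' ?distxx ?e' ?e ?subrr ?normr0 //=.
    by rewrite subr0 normr1.
  by rewrite sub0r normrN normr1.
- by rewrite !self subrr add0r addr0.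
by right; exists x, y; rewrite !self; split; rewrite ?ltr01 // subrr add0r addr0.
Qed.

(** A path from a point inside an edge to its image runs through endpoints of
the two edges, and its length accounts for the displacement of an endpoint; a
path inside a single edge would mean that [g] preserves the edge. *)
Lemma point_dist_ge g (p : T -> R) : realization p ->
  ((translation_len g)%:R <= point_dist p (point_act g p))%R.
Proof.
move=> [a [b [t [ab t01 ->]]]].
have vtx v : ((translation_len g)%:R <=
    point_dist (vertex_point R v) (point_act g (vertex_point R v)))%R.
  by rewrite point_act_vertex point_dist_vertex ler_nat translation_len_le.
have [t0|tn0] := eqVneq t 0%R.
  suff -> : bary a b t = vertex_point R a by exact: vtx.
  by apply/funext => w; rewrite vertex_pointE t0 /bary subr0 mul1r mul0r addr0.
have [t1|tn1] := eqVneq t 1%R.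
  suff -> : bary a b t = vertex_point R b by exact: vtx.
  by apply/funext => w; rewrite vertex_pointE t1 /bary subrr mul1r mul0r add0r.
case: ab => [e|ab].
  suff -> : bary a b t = vertex_point R a by exact: vtx.
  by apply/funext => w; rewrite vertex_pointE e /bary -mulrDl subrK mul1r.
have {tn0 tn1} [t0 t1] : (0 < t)%R /\ (t < 1)%R.
  by case/andP: t01 => ? ?; rewrite !lt_neqAle tn1 eq_sym tn0.
rewrite point_act_bary.
have val x y : adj x y -> bary x y t x = (1 - t)%R /\ bary x y t y = t.
  move=> xy; have xy' : (x == y) = false by apply/eqP => e; move: xy; rewrite e adj_irr.
  by rewrite /bary !eqxx (eq_sym y) xy' !mulr0 !mulr1 addr0 add0r.
have supp x y w : (0 < bary x y t w)%R -> w = x \/ w = y.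
  rewrite /bary; case: eqP => [|_]; first by left.
  by case: eqP => [|_]; [right | rewrite !mulr0 addr0 ltxx].
have [pa pb] := val _ _ ab.
have gab : adj (g a) (g b) by rewrite aut_adj.
have [qa qb] := val _ _ gab.
apply: lb_le_inf.
  exists ((1 - bary a b t a) + (d a (g a))%:R + (1 - bary (g a) (g b) t (g a)))%R.
  by right; exists a, (g a); split; rewrite // ?pa ?qa subr_gt0.
move=> _ [[u [v [uv cp cq ->]]]|[u [v [pu qv ->]]]].
  have ne s : (0 < s)%R -> s != 0%R by move=> s0; rewrite gt_eqF.
  have au : a = u \/ a = v by apply: cp; rewrite /= pa ne // subr_gt0.
  have bu : b = u \/ b = v by apply: cp; rewrite /= pb ne.
  have gau : g a = u \/ g a = v by apply: cq; rewrite /= qa ne // subr_gt0.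
  have gbu : g b = u \/ g b = v by apply: cq; rewrite /= qb ne.
  suff ell : elliptic g by move/elliptic_len: ell => ->; exact: normr_ge0.
  have [ga|ga] := eqVneq (g a) a; first by left; exists a.
  have [gb|gb] := eqVneq (g b) b; first by left; exists b.
  right; exists a, b; move/eqP: ga; move/eqP: gb => gb ga.
  have ab' : a <> b by move=> e; move: ab; rewrite e adj_irr.
  by split=> //; case: au => E1; case: bu => E2; case: gau => E3; case: gbu => E4; congruence.
have L x y : translation_len g <= d x y + 1 ->
   ((translation_len g)%:R <= (d x y)%:R + 1 :> R)%R.
  by rewrite -(ler_nat R) natrD.
have L0 x : ((translation_len g)%:R <= (d x (g x))%:R :> R)%R.
  by rewrite ler_nat translation_len_le.
have da := translation_len_le g a.
have ab1 := dist_adj ab; have gab1 := dist_adj gab.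
case: (supp _ _ _ pu) (supp _ _ _ qv) => -> [] ->; rewrite ?pa ?pb ?qa ?qb.
- by have := L0 a; lra.
- have /L : translation_len g <= d a (g b) + 1.
    by have := dist_triangle a (g b) (g a); dlia.
  by lra.
- have /L : translation_len g <= d b (g a) + 1.
    by have := dist_triangle a b (g a); dlia.
  by lra.
by have := L0 b; lra.
Qed.

Lemma translation_lengthE g : translation_length R g = ((translation_len g)%:R)%R.
Proof.
have [p rp ep] : exists2 p : T -> R, realization p &
    point_dist p (point_act g p) = ((translation_len g)%:R)%R.
  have [[u [v [uv gu gv]]]|ninv] := pselect (exists u v, inverts g u v); last first.
    have [|v av] := @noninversion_axial _ g; first by move=> u v uv; apply: ninv; exists u, v.
    exists (vertex_point R v); last by rewrite point_act_vertex point_dist_vertex (axial_len av).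
    by exists v, v, 0%R; split; rewrite ?lexx ?ler01 //; left.
  have rm : realization (midpoint R u v).
    by exists u, v, (2^-1)%R; split=> //; [right | apply/andP; split; lra].
  exists (midpoint R u v) => //.
  have l0 : translation_len g = 0 by apply/elliptic_len; right; exists u, v.
  have am : point_act g (midpoint R u v) = midpoint R u v.
    rewrite /midpoint point_act_bary gu gv; apply/funext => w; rewrite /bary; lra.
  apply/eqP; rewrite eq_le point_dist_ge // andbT am l0; apply: ge_inf.
    exists 0%R => _ [[u' [v' [_ _ _ ->]]]|[u' [v' [_ _ ->]]]]; first exact: normr_ge0.
    have m1 w : (midpoint R u v w <= 1)%R.
      by rewrite /midpoint /bary; case: eqP; case: eqP => _ _ /=; lra.
    have := m1 u'; have := m1 v'; have : (0 <= (d u' v')%:R :> R)%R by [].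
    lra.
  have cm : carried_by (midpoint R u v) u v.
    move=> w /=; rewrite /midpoint /bary; case: (eqVneq w u) => [->|_]; first by left.
    by case: (eqVneq w v) => [->|_]; [right | rewrite !mulr0 addr0 eqxx].
  by left; exists u, v; split=> //; rewrite subrr normr0.
rewrite /translation_length; apply/eqP; rewrite eq_le; apply/andP; split.
  rewrite -ep; apply: ge_inf; last by exists p.
  by exists ((translation_len g)%:R)%R => _ [q rq <-]; exact: point_dist_ge.
apply: lb_le_inf; first by exists (point_dist p (point_act g p)), p.
by move=> _ [q rq <-]; exact: point_dist_ge.
Qed.

Lemma min_set_axial g v : min_set g (vertex_point R v) <-> axial g v.
Proof.
rewrite /min_set /= translation_lengthE point_act_vertex point_dist_vertex.
have rv : realization (vertex_point R v).
  by exists v, v, 0%R; split; rewrite ?lexx ?ler01 //; left.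
split=> [[_ /eqP]|/axial_len ->] //; rewrite eqr_nat => /eqP e.
have [ell|/hyperbolic_axial ex] := pselect (elliptic g); last exact: axial_min.
by move/elliptic_len: ell => l0; apply: fixed_axial; apply/esym/dist_eq0; rewrite e.
Qed.

Lemma fix_midpointP (G : set (aut T)) u v g : adj u v -> fix_midpoint R G u v g <->
  G g /\ ((g u = u /\ g v = v) \/ (g u = v /\ g v = u)).
Proof.
move=> uv; have uv' : u <> v by move=> e; move: uv; rewrite e adj_irr.
rewrite /fix_midpoint /= /midpoint point_act_bary; split=> -[Gg e]; split=> //; last first.
  by case: e => -[-> ->] //; apply/funext => w; rewrite /bary; lra.
have S w : bary (g u) (g v) 2^-1%R w <> 0%R :> R -> w = u \/ w = v.
  rewrite e /bary; case: eqP => [|_]; first by left.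
  by case: eqP => [|_]; [right | rewrite !mulr0 addr0].
have gu : g u = u \/ g u = v.
  by apply: S; rewrite /bary eqxx; case: eqP => _ /=; lra.
have gv : g v = u \/ g v = v.
  by apply: S; rewrite /bary eqxx; case: eqP => _ /=; lra.
have guv : g u <> g v by move/aut_inj.
by case: gu gv => gu [] gv; [congruence | left | right | congruence].
Qed.

(** A hyperbolic element enters [v] from the direction of [g^-1 v] and leaves
it in the direction of [g v]. *)
Lemma vertex_semigroupP (G : set (aut T)) v (I : set (T * T)) g : I `<=` edges_to v ->
  vertex_semigroup R G v I g <-> G g /\
  ((g v = v /\ forall x, adj v x -> I (x, v) <-> I (g x, v)) \/
   (exists a b, [/\ adj v a /\ adj v b, I (a, v), ~ I (b, v),
     d ((g^-1)%g v) v = (d ((g^-1)%g v) a).+1 & d v (g v) = (d b (g v)).+1])).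
Proof.
move=> Isub; rewrite /vertex_semigroup /=; split.
  move=> [Gg /min_set_axial ax ell hyp]; split=> //.
  have [el|hy] := pselect (elliptic g).
    left; have gv : g v = v.
      by apply/esym/dist_eq0; rewrite -(axial_len ax); apply/elliptic_len.
    split=> // x vx; have {ell hyp} E := ell el; split=> H.
      by rewrite -E; exists (x, v); rewrite //= gv.
    move: H; rewrite -{1}E => -[[x' v'] Ix' [/aut_inj <-]].
    by rewrite -[in X in _ = X]gv => /aut_inj <-.
  right; have [[[a v'] Iav' [c [cc [k kpos Hk]] [n [ea]]]]] := hyp hy.
  move=> ev [_ [[b v''] [[/= bv ev''] nI] <-] [c' [cc' [k' kpos' Hk']] [m [/= e1 e2]]]].
  subst v''; have [/= av ev'] := Isub _ Iav'; rewrite ev' in av Iav' ev.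
  have gc : (g^-1)%g v = c (n + 1 - Posz k)%R.
    by apply: (@aut_inj _ g); rewrite autVKg Hk subrK.
  have e3 : d ((g^-1)%g v) v = (d ((g^-1)%g v) a).+1.
    by rewrite gc ev ea !cc; lia.
  exists a, b; split=> //; first by split; rewrite adj_sym.
  by rewrite e1 Hk' e2 !cc'; lia.
move=> [Gg [[gv E]|[a [b [[va vb] Ia nIb da db]]]]].
  have el : elliptic g by left; exists v.
  split=> // [|_]; first by apply/min_set_axial; exact: fixed_axial.
  apply/seteqP; split=> [_ [[x w] Ix <-]|[x w] Ix] /=.
      have [/= xv wv] := Isub _ Ix; rewrite wv in xv Ix *; rewrite gv.
      have vx : adj v x by rewrite adj_sym.
      exact: (E x vx).1.
    have [/= xv wv] := Isub _ Ix; rewrite wv in xv Ix *.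
    exists ((g^-1)%g x, v); last by rewrite /= autVK gv.
    have vx : adj v ((g^-1)%g x) by rewrite -(aut_adj g) gv autVKg adj_sym.
    by apply: (E _ vx).2; rewrite autVKg.
change (d ((g^-1)%g v) v = (d ((g^-1)%g v) a).+1) in da.
have ab : a <> b by move=> e; rewrite e in Ia.
have vV : d ((g^-1)%g v) v = d v (g v) by rewrite dist_autV.
have e1 : d ((g^-1)%g v) b = (d ((g^-1)%g v) v).+1.
  case: (dist_adj_cases ((g^-1)%g v) vb) => // e; case: ab.
  by apply: (@closer_neighbour_unique _ ((g^-1)%g v) v) => //; lia.
have e2 := geodesic_concat vb e1 db.
have ax : axial g v.
  by rewrite /axial; have := dist_autV g v (g v); lia.
have hy : hyperbolic g by apply: axial_hyperbolic ax _; lia.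
have [|c [cc c0 Hc]] := axis_ex ax; first lia.
have l := axial_len ax; set k := translation_len g in l Hc.
have axc : is_axis g c by split=> //; exists k => //; lia.
have gvc : g v = c (Posz k) by rewrite -c0 Hc add0r.
have gVc : (g^-1)%g v = c (- Posz k)%R.
  by apply: (@aut_inj _ g); rewrite autVKg Hc -c0; congr c; lia.
have cb : c 1%R = b.
  apply: (@between_unique _ v (g v)).
  - by rewrite gvc -c0 !cc; lia.
  - by rewrite (dist_adj vb) add1n.
  by rewrite (dist_adj vb) -c0 cc.
have ca : c (- 1)%R = a.
  apply: (@between_unique _ v ((g^-1)%g v)).
  - by rewrite gVc -c0 !cc; lia.
  - by rewrite (dist_adj va) add1n dist_sym da dist_sym.
  by rewrite (dist_adj va) -c0 cc.
split=> [//||/hy//|_]; first exact/min_set_axial.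
split.
  exists (a, v) => //; exists c => //; exists (- 1)%R.
  by rewrite ca addrC subrr c0.
exists (v, b); first by exists (b, v) => //; split=> //; split; rewrite //= adj_sym.
by exists c => //; exists 0%R; rewrite add0r c0 cb.
Qed.

End Points.

(** * Semigroups with additive translation length *)

Section Stable.
Variable T : tree.
Implicit Types (u v x y z w : T) (g h : aut T) (r : nat -> T).

Local Notation d := (@dist T).

(** A self-injection of a finite set is onto. *)
Lemma finite_stable v g (P : T -> Prop) : locally_finite T -> g v = v ->
  (forall x, adj v x -> P (g x) -> P x) -> forall x, adj v x -> P x -> P (g x).
Proof.
move=> fin gv H x vx Px.
pose l := seq.filter (fun y => `[< P y >]) (nbr_seq v).
have lu : uniq l by apply: filter_uniq; exact: nbr_seq_uniq.
have lP y : y \in l <-> adj v y /\ P y.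
  rewrite mem_filter mem_nbr_seq //; split=> [/andP[/asboolP]|[vy /asboolP Py]] //.
  exact/andP.
have gV : (g^-1)%g v = v by rewrite -{1}gv autKg.
have lu' : uniq (map (g^-1)%g l) by rewrite map_inj_uniq //; exact: aut_inj.
have sub : {subset map (g^-1)%g l <= l}.
  move=> _ /mapP[y /lP[vy Py] ->]; apply/lP.
  have vgy : adj v ((g^-1)%g y) by rewrite -{1}gV aut_adj.
  by split=> //; apply: H => //; rewrite autVKg.
have [|_ E] := uniq_min_size lu' sub; first by rewrite size_map.
have : x \in l by apply/lP.
by rewrite -E => /mapP[y /lP[_ Py] ->]; rewrite autVKg.
Qed.

Lemma axial_projection g v : (exists x, axial g x) ->
  exists p, axial g p /\ forall x, axial g x -> d v x = d v p + d p x.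
Proof.
move=> ex; have [p ap e] := displacement v ex; exists p; split=> // x ax.
have [m [m1 m2 m3]] := median_ex v p x.
have am : axial g m by apply: axial_convex ap ax _; rewrite m3.
have := dist_triangle v m (g v); have := dist_triangle m (g m) (g v).
by have := axial_len am; rewrite dist_aut; dlia.
Qed.

(** Helly's theorem for the sets of axial vertices: seen from a vertex, of two
intersecting ones the farther entrance lies in both. So the entrances are
linearly ordered along one geodesic, which is finite or a ray. *)
Lemma axial_helly (S : set (aut T)) : (forall g, S g -> exists x, axial g x) ->
  (forall g h, S g -> S h -> exists2 x, axial g x & axial h x) ->
  (exists v, forall g, S g -> axial g v) \/
  (exists r, is_ray r /\ forall g, S g -> exists N, forall n, axial g (r (n + N))).
Proof.
have [v] := tree_inhabited T; move=> ex meet.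
have /choice[P HP] g : exists p, S g ->
    axial g p /\ forall x, axial g x -> d v x = d v p + d p x.
  have [Sg|nS] := pselect (S g); last by exists v.
  by have [p Hp] := axial_projection v (ex g Sg); exists p.
have cmp g h : S g -> S h -> d v (P g) <= d v (P h) ->
    axial g (P h) /\ d v (P h) = d v (P g) + d (P g) (P h).
  move=> Sg Sh le; have [ag pg] := HP g Sg; have [ah ph] := HP h Sh.
  suff agh : axial g (P h) by split=> //; exact: pg.
  have [x ax bx] := meet g h Sg Sh.
  apply: (axial_convex ag ax); have := pg x ax; have := ph x bx.
  have := dist_triangle v (P g) (P h).
  by fp v x (P g) (P h); dlia.
have [[h Sh mx]|nmax] := pselect (exists2 h, S h & forall g, S g -> d v (P g) <= d v (P h)).
  by left; exists (P h) => g Sg; have [] := cmp g h Sg Sh (mx g Sg).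
have [[g0 Sg0]|no] := pselect (exists g, S g); last first.
  by left; exists v => g Sg; case: no; exists g.
right.
have /choice[h Hh] n : exists g, S g /\ n <= d v (P g).
  elim: n => [|n [g [Sg le]]]; first by exists g0.
  apply: contrapT => no; apply: nmax; exists g => // f Sf.
  by rewrite leqNgt; apply/negP => lt; apply: no; exists f; split=> //; lia.
have /choice[r Hr] n : exists z, d v z = n /\ d v (P (h n)) = n + d z (P (h n)).
  by apply: between_ex; case: (Hh n).
have on g n : S g -> n <= d v (P g) -> d v (P g) = n + d (r n) (P g).
  move=> Sg le; have [Sh leh] := Hh n; have [r1 r2] := Hr n.
  have [le'|/ltnW le'] := leqP (d v (P g)) (d v (P (h n))).
    have [_ e] := cmp _ _ Sg Sh le'; have := dist_triangle v (r n) (P g).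
    by fp v (P (h n)) (P g) (r n); dlia.
  have [_ e] := cmp _ _ Sh Sg le'; have := dist_triangle v (r n) (P g).
  by have := dist_triangle (r n) (P (h n)) (P g); dlia.
have rv n : d v (r n) = n by case: (Hr n).
exists r; split.
  move=> m n; set N := maxn m n; have [Sh leh] := Hh N.
  have em := @on (h N) m Sh; have en := @on (h N) n Sh.
  have [lm ln] : m <= d v (P (h N)) /\ n <= d v (P (h N)) by lia.
  have {}em := em lm; have {}en := en ln.
  have := rv m; have := rv n; have := dist_triangle v (r m) (r n).
  have := dist_triangle v (r n) (r m).
  by fp v (P (h N)) (r m) (r n); dlia.
move=> g Sg; exists (d v (P g)) => n; set m := n + d v (P g).
have [Sh leh] := Hh m.
have [|agh e] := cmp g (h m) Sg Sh; first lia.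
have [ag pg] := HP g Sg; have em := on _ _ Sh leh.
apply: (axial_convex ag agh); have := rv m; have := dist_triangle v (P g) (r m).
by fp v (P (h m)) (P g) (r m); dlia.
Qed.

(** By [axis_mem] the ray runs along the axis, in one of its two directions. *)
Lemma axial_ray_shift g r N : is_ray r -> (forall n, axial g (r (n + N))) ->
  exists a b, forall n, g (r (n + a)) = r (n + b).
Proof.
move=> rr ax; have ax0 := ax 0.
have [l0|lpos] := posnP (d (r N) (g (r N))).
  have len0 : translation_len g = 0 by rewrite (axial_len ax0).
  exists N, N => n; apply/esym/dist_eq0.
  by rewrite -(axial_len (ax n)).
have [c [cc c0 Hc]] := axis_ex ax0 lpos.
have kpos : 0 < translation_len g by rewrite (axial_len ax0).
set k := translation_len g in Hc kpos.
have /choice[f Hf] n : exists j, r (n + N) = c j by exact: axis_mem cc kpos Hc (ax n).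
have [|E|E] := @isometry_nat_int f.
- by move=> m n; rewrite -cc -!Hf rr; lia.
- exists N, (k + N) => n; rewrite addnA !Hf Hc E (E (n + k)); congr c; lia.
exists (k + N), N => n; rewrite addnA !Hf Hc E (E n); congr c; lia.
Qed.

Lemma shift_mul g h r a b a' b' : (forall n, g (r (n + a)) = r (n + b)) ->
  (forall n, h (r (n + a')) = r (n + b')) ->
  forall n, (g * h)%g (r (n + (a + a'))) = r (n + (b + b')).
Proof.
move=> Hg Hh n; rewrite /= addnA Hh -addnA (addnC a) addnA Hg.
by congr r; lia.
Qed.

Lemma shift_len_abs g r a b : is_ray r -> (forall n, g (r (n + a)) = r (n + b)) ->
  translation_len g = (b - a) + (a - b).
Proof.
move=> rr H; have [le|/ltnW le] := leqP a b.
  by have [_ ->] := shift_len rr le H; lia.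
have [_] := shift_len rr le (shiftV H); rewrite translation_lenV => ->; lia.
Qed.

End Stable.

Section Containment.
Variables (R : realType) (T : tree).
Implicit Types (u v x y z w : T) (g h : aut T) (r : nat -> T).

Local Notation d := (@dist T).

Hypothesis fin : locally_finite T.
Variable G : set (aut T).
Hypothesis Ggrp : is_subgroup G.

(** At a common axial vertex [v], additivity for [g h] says that [g^-1 v] and [h v]
lie in different directions; so the directions of the [g^-1 v] can serve as [I]. *)
Lemma axial_vertex_contained S v : length_additive G S -> (forall g, S g -> axial g v) ->
  exists2 M, standard_semigroup R G M & S `<=` M.
Proof.
move=> [SG SM Sadd] ax.
have [fixv|] := pselect (forall g, S g -> g v = v).
  by exists (fix_vertex G v); [constructor | move=> g Sg; split; [exact: SG | exact: fixv]].
move=> /existsNP[h0 /not_implyP[Sh0 h0v]].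
pose dir g a := d ((g^-1)%g v) v = (d ((g^-1)%g v) a).+1.
pose I : set (T * T) :=
  [set e | [/\ adj e.1 e.2, e.2 = v & exists g, [/\ S g, g v <> v & dir g e.1]]].
have Isub : I `<=` edges_to v by move=> e [].
have out h b : S h -> adj v b -> d v (h v) = (d b (h v)).+1 -> ~ I (b, v).
  move=> Sh vb db [_ _ [g [Sg gv /= ab]]].
  have := Sadd g h Sg Sh; rewrite (axial_len (ax _ (SM _ _ Sg Sh))).
  rewrite (axial_len (ax _ Sg)) (axial_len (ax _ Sh)) /=.
  rewrite -(dist_autV g) => e.
  have := dist_autV g v v; have := dist_triangle ((g^-1)%g v) b (h v).
  by move: ab; rewrite /dir; lia.
have dirE g : g v <> v -> exists2 a, adj v a & dir g a.
  move=> gv; have : d v ((g^-1)%g v) <> 0.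
    by move/dist_eq0 => e; apply: gv; rewrite {1}e autVKg.
  case e : (d v ((g^-1)%g v)) => [//|n] _; have [a va an] := dist_step e.
  by exists a => //; rewrite /dir dist_sym e dist_sym an.
have dirO h : h v <> v -> exists2 b, adj v b & d v (h v) = (d b (h v)).+1.
  move=> hv; have : d v (h v) <> 0 by move/dist_eq0 => e; apply: hv.
  case e : (d v (h v)) => [//|n] _; have [b vb bn] := dist_step e.
  by exists b; rewrite // bn.
exists (vertex_semigroup R G v I).
  have [a va da] := dirE h0 h0v; have [b vb db] := dirO h0 h0v.
  constructor; last by exists (a, v); split; rewrite /= 1?adj_sym //; exists h0.
  split=> // sub; apply: (out h0 b Sh0 vb db); apply: sub.
  by split; rewrite //= adj_sym.
move=> g Sg; apply/vertex_semigroupP => //; split; first exact: SG.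
have [gv|gv] := pselect (g v = v); last first.
  right; have [a va da] := dirE g gv; have [b vb db] := dirO g gv.
  exists a, b; split=> //; last exact: (out g b).
  by split; rewrite /= 1?adj_sym //; exists g.
have gVv : (g^-1)%g v = v by rewrite -{1}gv autKg.
left; split=> //.
have back x : adj v x -> I (g x, v) -> I (x, v).
  move=> vx [_ _ [h [Sh hv dh]]]; split; rewrite /= 1?adj_sym //.
  exists (h * g)%g; split; [exact: SM | by rewrite /= gv |].
  have e : ((h * g)^-1)%g v = (g^-1)%g ((h^-1)%g v) by [].
  by rewrite /dir e !(dist_autV g) gv.
move=> x vx; split; last exact: back.
exact: (finite_stable (P := fun x => I (x, v)) fin gv back).
Qed.

(** Shifts in opposite directions would partly cancel in a product. *)
Lemma shifted_ray_contained S r : length_additive G S -> is_ray r ->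
  (forall g, S g -> exists a b, forall n, g (r (n + a)) = r (n + b)) ->
  exists2 M, standard_semigroup R G M & S `<=` M.
Proof.
move=> [SG SM Sadd] rr shift.
have er : ends T (end_of r) by exists r.
have [pos|] := pselect (S `<=` fix_end_plus G (end_of r)).
  by exists (fix_end_plus G (end_of r)) => //; constructor.
move=> /existsNP[g /not_implyP[Sg ng]].
have [a [b Hg]] := shift g Sg.
have lt : b < a.
  by rewrite ltnNge; apply/negP => le; apply: ng; apply/fix_end_plusP => //; split; [exact: SG | exists a, b].
exists (fix_end_minus G (end_of r)); first by constructor.
move=> h Sh; apply/fix_end_minusV => //; apply/fix_end_plusP => //.
split; first by case: Ggrp => _ _; apply; exact: SG.
have [a' [b' Hh]] := shift h Sh; exists b', a'; split; last exact: shiftV.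
have := Sadd g h Sg Sh.
rewrite (shift_len_abs rr (shift_mul Hg Hh)) (shift_len_abs rr Hg) (shift_len_abs rr Hh).
lia.
Qed.

Lemma length_additive_contained S : length_additive G S -> exists2 M, standard_semigroup R G M & S `<=` M.
Proof.
move=> Sad; have [SG SM Sadd] := Sad.
have [[g [u [v [Sg inv]]]]|ninv] := pselect (exists g u v, S g /\ inverts g u v).
  exists (fix_midpoint R G u v); first by apply: StdMidpoint inv; exact: SG.
  have [uv _ _] := inv.
  move=> h Sh; apply/fix_midpointP => //; split; first exact: SG.
  apply: (inversion_preserves_edge inv); rewrite Sadd //.
  suff -> : translation_len g = 0 by [].
  by apply/elliptic_len; right; exists u, v.
have ex g : S g -> exists x, axial g x.
  by move=> Sg; apply: noninversion_axial => u v uv; apply: ninv; exists g, u, v.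
have [|[v ax]|[r [rr H]]] := axial_helly ex.
- by move=> g h Sg Sh; apply: axial_meet; [exact: ex | exact: ex | rewrite Sadd].
- exact: axial_vertex_contained ax.
by apply: (shifted_ray_contained Sad rr) => g /H[N]; exact: axial_ray_shift.
Qed.

End Containment.

(** * The standard semigroups are maximal *)

Section Maximality.
Variables (R : realType) (T : tree).
Implicit Types (u v x y z w : T) (g h : aut T) (r : nat -> T).

Local Notation d := (@dist T).

Hypothesis fin : locally_finite T.
Hypothesis branch : branching T.
Variable G : set (aut T).
Hypothesis Ggrp : is_subgroup G.
Hypothesis G2 : two_transitive_on_ends G.

Let GM := subgroupM Ggrp.
Let GV := subgroupV Ggrp.

Definition maximal_additive M :=
  length_additive G M /\ forall S, length_additive G S -> M `<=` S -> S `<=` M.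

Lemma additive_zero M : M `<=` G -> (forall g h, M g -> M h -> M (g * h)%g) ->
  (forall g, M g -> translation_len g = 0) -> length_additive G M.
Proof. by move=> MG MM l0; split=> // g h Mg Mh; rewrite !l0 //; exact: MM. Qed.

(** The fixator contains an inversion of the edge, which forces every element
of a larger semigroup to preserve the edge. *)
Lemma midpoint_maximal u v g0 : G g0 -> inverts g0 u v ->
  maximal_additive (fix_midpoint R G u v).
Proof.
move=> Gg0 inv; have [uv g0u g0v] := inv; split.
  apply: additive_zero.
  - by move=> g /(fix_midpointP R G g uv)[].
  - move=> g h /(fix_midpointP R G g uv)[Gg Hg] /(fix_midpointP R G h uv)[Gh Hh].
    apply/(fix_midpointP R G _ uv); split; first exact: GM.
    by case: Hg Hh => -[g1 g2] [] [h1 h2]; rewrite /= h1 h2 g1 g2; [left|right|right|left].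
  move=> g /(fix_midpointP R G g uv)[_ H]; apply/elliptic_len.
  by case: H => -[g1 g2]; [left; exists u | right; exists u, v].
move=> S [SG SM Sadd] sub g Sg; apply/(fix_midpointP R G _ uv); split; first exact: SG.
have Sg0 : S g0 by apply: sub; apply/(fix_midpointP R G _ uv); split=> //; right.
apply: (inversion_preserves_edge inv); rewrite Sadd //.
suff -> : translation_len g0 = 0 by [].
by apply/elliptic_len; right; exists u, v.
Qed.

(** If [g] moves [v], then, composed with elements of the stabilizer of [v], it can
be made to send [v] back to [g^-1 v], hence elliptic, or away from it, hence
hyperbolic. *)
Lemma vertex_maximal v : maximal_additive (fix_vertex G v).
Proof.
split.
  apply: additive_zero; first by move=> g [].
    by move=> g h [Gg gv] [Gh hv]; split; [exact: GM | rewrite /= hv].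
  by move=> g [_ gv]; apply/elliptic_len; left; exists v.
move=> S [SG SM Sadd] sub g Sg; split; first exact: SG.
apply: contrapT => gv; set D := d v (g v).
have Dpos : D <> 0 by move/dist_eq0 => e; apply: gv.
have vgV : d v ((g^-1)%g v) = D by rewrite dist_sym dist_autV.
have len (h : aut T) : G h -> h v = v -> translation_len (h * g)%g = translation_len g.
  move=> Gh hv; rewrite Sadd //; last by apply: sub.
  suff -> : translation_len h = 0 by [].
  by apply/elliptic_len; left; exists v.
have [|h1 [Gh1 h1v h1g]] := @sphere_transitive T G Ggrp G2 branch v (g v) ((g^-1)%g v) => //.
have := len h1 Gh1 h1v; rewrite (translation_lenE _ v) /= h1g autVKg h1v distxx.
have [r [rr r0 H]] := ray_away branch ((g^-1)%g v) v.
have rD : d v (r D) = D by rewrite -r0 rr; lia.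
have [|h2 [Gh2 h2v h2g]] := @sphere_transitive T G Ggrp G2 branch v (g v) (r D) => //.
have := len h2 Gh2 h2v; rewrite (translation_lenE _ v) /= h2g.
have -> : d v (h2 (g (r D))) = D + D.
  by rewrite -{1}h2v dist_aut -dist_autV H dist_autV.
by rewrite rD => <-; lia.
Qed.

Lemma opposite_directions v x y a b : adj v a -> adj v b -> a <> b ->
  d x v = (d x a).+1 -> d v y = (d b y).+1 -> d x y = d x v + d v y.
Proof.
move=> va vb ab xa yb; apply: (geodesic_concat vb) => //.
case: (dist_adj_cases x vb) => // e; case: ab.
by apply: (@closer_neighbour_unique _ x v) => //; lia.
Qed.

Lemma ray_through v y : exists r, [/\ is_ray r, r 0 = v & r (d v y) = y].
Proof.
have [c [cc c0 cy]] := line_through branch v y.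
by exists (pos_ray c); split=> //; exact: pos_rayP.
Qed.

Section VertexSemigroup.
Variables (v : T) (I : set (T * T)).
Hypothesis Isub : I `<=` edges_to v.

Local Notation M := (vertex_semigroup R G v I).

Definition inward x := exists a, [/\ adj v a, I (a, v) & d v x = (d a x).+1].
Definition outward x := exists a, [/\ adj v a, ~ I (a, v) & d v x = (d a x).+1].
Definition stable g := forall x, adj v x -> I (x, v) <-> I (g x, v).

Lemma vertex_semigroup_directions g : M g <-> G g /\
  ((g v = v /\ stable g) \/ (inward ((g^-1)%g v) /\ outward (g v))).
Proof.
split=> [/(vertex_semigroupP R G g Isub)[Gg H]|[Gg H]].
  split=> //; case: H => [|[a [b [[va vb] Ia Ib da db]]]]; [by left | right].
  by split; [exists a; split; rewrite // dist_sym da dist_sym | exists b].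
apply/(vertex_semigroupP R G g Isub); split=> //.
case: H => [|[[a [va Ia da]] [b [vb Ib db]]]]; [by left | right].
by exists a, b; split=> //; rewrite dist_sym da dist_sym.
Qed.

Lemma vertex_semigroup_axial g : M g -> axial g v.
Proof. by move=> [_ /min_set_axial]. Qed.

Lemma inward_outward x y : inward x -> outward y -> d x y = d x v + d v y.
Proof.
move=> [a [va Ia da]] [b [vb Ib db]]; apply: (opposite_directions va vb) => //.
  by move=> ab; rewrite ab in Ia.
by rewrite dist_sym da dist_sym.
Qed.

Lemma inward_extend x y : inward x -> d v y = d v x + d x y -> inward y.
Proof.
move=> [a [va Ia da]] e; exists a; split=> //.
by have := dist_triangle a x y; case: (dist_adj_cases y va); dlia.
Qed.

Lemma outward_extend x y : outward x -> d v y = d v x + d x y -> outward y.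
Proof.
move=> [a [va Ia da]] e; exists a; split=> //.
by have := dist_triangle a x y; case: (dist_adj_cases y va); dlia.
Qed.

Lemma stableV g : stable g -> g v = v -> stable (g^-1)%g.
Proof.
move=> st gv x vx; have gVv : (g^-1)%g v = v by rewrite -{1}gv autKg.
have vx' : adj v ((g^-1)%g x) by rewrite -{1}gVv aut_adj.
by have := st _ vx'; rewrite autVKg; tauto.
Qed.

Lemma inward_aut g x : g v = v -> stable g -> inward x -> inward (g x).
Proof.
move=> gv st [a [va Ia da]]; exists (g a); split.
- by rewrite -{1}gv aut_adj.
- exact: (st a va).1.
by rewrite -{1}gv !dist_aut.
Qed.

Lemma outward_aut g x : g v = v -> stable g -> outward x -> outward (g x).
Proof.
move=> gv st [a [va Ia da]]; exists (g a); split.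
- by rewrite -{1}gv aut_adj.
- by move/(st a va).
by rewrite -{1}gv !dist_aut.
Qed.

(** As no direction is both inward and outward, products do not backtrack at
[v]. *)
Lemma vertex_semigroup_additive : length_additive G M.
Proof.
have prod g h : M g -> M h -> M (g * h)%g /\ d v (g (h v)) = d v (g v) + d v (h v).
  move=> /vertex_semigroup_directions[Gg Hg] /vertex_semigroup_directions[Gh Hh].
  have Ggh := GM Gg Gh.
  have VE : ((g * h)^-1)%g v = (h^-1)%g ((g^-1)%g v) by [].
  have fixV (f : aut T) : f v = v -> (f^-1)%g v = v by move=> fv; rewrite -{1}fv autKg.
  case: Hg Hh => [[gv gst]|[gin gout]] [[hv hst]|[hin hout]].
  - split; last by rewrite hv gv !distxx.
    apply/vertex_semigroup_directions; split=> //; left; split; first by rewrite /= hv.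
    by move=> x vx; rewrite (hst x vx); apply: gst; rewrite -{1}hv aut_adj.
  - split; last by rewrite -{1}gv dist_aut gv distxx.
    apply/vertex_semigroup_directions; split=> //; right; split.
      by rewrite VE (fixV g).
    exact: (outward_aut gv gst hout).
  - split; last by rewrite hv distxx addn0.
    apply/vertex_semigroup_directions; split=> //; right; split; last by rewrite /= hv.
    by rewrite VE; exact: (inward_aut (fixV h hv) (stableV hst hv) gin).
  have e := inward_outward gin hout.
  have e1 : d v (g (h v)) = d v (g v) + d v (h v).
    by rewrite -(dist_autV g v (h v)) e dist_autV.
  split=> //; apply/vertex_semigroup_directions; split=> //; right; split.
    rewrite VE; apply: (inward_extend hin).
    by rewrite dist_aut; have := dist_autV h ((g^-1)%g v) v; have := dist_autV h v v; dlia.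
  by apply: (outward_extend gout); rewrite /= dist_aut.
split.
- by move=> g [].
- by move=> g h Mg Mh; have [] := prod g h Mg Mh.
move=> g h Mg Mh; have [Mgh e] := prod g h Mg Mh.
by rewrite !(axial_len (vertex_semigroup_axial _)) // (axial_len (vertex_semigroup_axial Mg)).
Qed.

Lemma vertex_semigroup_translation r s N : is_ray r -> is_ray s ->
  r 0 = v -> s 0 = v -> ~ I (r 1, v) -> I (s 1, v) -> 0 < N ->
  exists h c, [/\ M h, is_line c, pos_ray c = r, neg_ray c = s &
    forall n, h (c n) = c (n + Posz (2 * N))%R].
Proof.
move=> rr ss r0 s0 nI Is Npos.
have ne : r 1 <> s 1 by move=> e; rewrite e in nI.
have [c [cc cr cs]] := join_rays rr ss (etrans r0 (esym s0)) ne.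
have [h Gh Hh] := even_translation Ggrp G2 branch N cc.
exists h, c; split=> //; apply/vertex_semigroup_directions; split=> //; right.
have c0 : c 0%R = v by rewrite -r0 -cr.
have c1 : c 1%R = r 1 by rewrite -cr.
have cm1 : c (- 1)%R = s 1 by rewrite -cs.
have hv : h v = c (Posz (2 * N)) by rewrite -c0 Hh add0r.
have hVv : (h^-1)%g v = c (- Posz (2 * N))%R.
  by apply: (@aut_inj _ h); rewrite autVKg Hh addNr c0.
split.
  exists (s 1); split=> //; first by apply: dist1_adj; rewrite -s0 ss.
  by rewrite hVv -c0 -cm1 !cc; lia.
exists (r 1); split=> //; first by apply: dist1_adj; rewrite -r0 rr.
by rewrite hv -c0 -c1 !cc; lia.
Qed.

Lemma first_step r x a : is_ray r -> r 0 = v -> r (d v x) = x -> adj v a ->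
  d v x = (d a x).+1 -> r 1 = a.
Proof.
move=> rr r0 rx va dx; have va1 := dist_adj va.
apply: (@between_unique _ v x); last by rewrite -r0 rr r0 va1.
  by rewrite -{1}r0 -{1}rx -r0 -{2}rx !rr r0; lia.
by rewrite dx va1.
Qed.

Lemma ray_step a : adj v a -> exists r, [/\ is_ray r, r 0 = v & r 1 = a].
Proof. by move=> /dist_adj va; have [r] := ray_through v a; rewrite va => H; exists r. Qed.

(** An element [g] of a larger additive semigroup cannot send [v] into an inward
direction, since it could be followed by a translation [h] back through
[v] with [h g] translating less than [h]; dually for [g^-1 v], and for
the edges at [v] when [g] fixes it. *)
Lemma vertex_semigroup_maximal : I `<` edges_to v -> I !=set0 -> maximal_additive M.
Proof.
move=> [_ /existsNP[[b0 v'] /not_implyP[[/= b0v e0] nIb0]]] [[a0 v''] Ia0].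
rewrite {}e0 in b0v nIb0.
have [/= a0v e1] := Isub Ia0; rewrite {}e1 in a0v Ia0.
rewrite adj_sym in b0v; rewrite adj_sym in a0v.
split; first exact: vertex_semigroup_additive.
move=> S [SG SM Sadd] sub g Sg.
have notin : ~ inward (g v).
  move=> [a [va Ia da]]; have [s [ss s0 sg]] := ray_through v (g v).
  have s1 := first_step ss s0 sg va da; rewrite -s1 in Ia.
  have [r [rr r0 r1]] := ray_step b0v; rewrite -r1 in nIb0.
  set D := d v (g v) in da sg.
  (* [h] moves [g v] to the other side of [v], at the same distance. *)
  have [|h [c [Mh cc cr cs Hh]]] :=
    vertex_semigroup_translation (N := D) rr ss r0 s0 nIb0 Ia; first lia.
  have := Sadd h g (sub _ Mh) Sg; have := translation_len_le (h * g)%g v.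
  have -> : (h * g)%g v = c (Posz D).
    by rewrite /= -sg -cs Hh; congr c; lia.
  have [_ ->] := line_axial 0%R cc Hh.
  have vc : v = c 0%R by rewrite -r0 -cr.
  by rewrite {1}vc cc; lia.
have notout : ~ outward ((g^-1)%g v).
  move=> [b [vb nIb db]]; have [r [rr r0 rg]] := ray_through v ((g^-1)%g v).
  have r1 := first_step rr r0 rg vb db; rewrite -r1 in nIb.
  have [s [ss s0 s1]] := ray_step a0v; rewrite -s1 in Ia0.
  set D := d v ((g^-1)%g v) in db rg.
  have [|h [c [Mh cc cr cs Hh]]] :=
    vertex_semigroup_translation (N := D) rr ss r0 s0 nIb Ia0; first lia.
  have := Sadd g h Sg (sub _ Mh); have := translation_len_le (g * h)%g (c (- Posz D)%R).
  have -> : (g * h)%g (c (- Posz D)%R) = c 0%R.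
    have -> : c 0%R = g (r D) by rewrite rg autVKg -r0 -cr.
    by rewrite /= Hh -cr /pos_ray; congr (g (c _)); lia.
  by have [_ ->] := line_axial 0%R cc Hh; rewrite cc; lia.
have dir x : x <> v -> inward x \/ outward x.
  move=> xv; have : d v x <> 0 by move/dist_eq0 => e; apply: xv.
  case e : (d v x) => [//|n] _; have [a va an] := dist_step e.
  by have [Ia|nIa] := pselect (I (a, v)); [left | right]; exists a; rewrite an.
apply/vertex_semigroup_directions; split; first exact: SG.
have [gv|gv] := pselect (g v = v); last first.
  right; have gVv : (g^-1)%g v <> v by move=> e; apply: gv; rewrite -{1}e autVKg.
  by case: (dir _ gv) (dir _ gVv) => // ? [].
left; split=> //.
have back x : adj v x -> I (g x, v) -> I (x, v).
  move=> vx Igx; apply: contrapT => nIx.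
  have vgx : adj v (g x) by rewrite -{1}gv aut_adj.
  have [s [ss s0 s1]] := ray_step vgx; rewrite -s1 in Igx.
  have [r [rr r0 r1]] := ray_step vx; rewrite -r1 in nIx.
  have [//|h [c [Mh cc cr cs Hh]]] := vertex_semigroup_translation (N := 1) rr ss r0 s0 nIx Igx.
  have := Sadd h g (sub _ Mh) Sg; have := translation_len_le (h * g)%g x.
  have -> : (h * g)%g x = x.
    rewrite /= -s1 -[in RHS]r1 -cr -cs; exact: (Hh (-1)%R).
  by have [_ ->] := line_axial 0%R cc Hh; rewrite distxx; lia.
move=> x vx; split; last exact: back.
exact: (finite_stable (P := fun x => I (x, v)) fin gv back).
Qed.

End VertexSemigroup.

(** If [g] moved the end, a line from its image to the end would be folded by [g],
and following [g] by a long translation along it would lose length; if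
[g] shifts away from the end, so would following it by a longer shift
towards it. *)
Lemma end_plus_maximal r : is_ray r -> maximal_additive (fix_end_plus G (end_of r)).
Proof.
move=> rr; have P g := fix_end_plusP G g rr; split.
  split.
  - by move=> g /P[].
  - move=> g h /P[Gg [a [b [le Hg]]]] /P[Gh [a' [b' [le' Hh]]]].
    apply/P; split; first exact: GM.
    by exists (a + a'), (b + b'); split; [lia | exact: shift_mul].
  move=> g h /P[Gg [a [b [le Hg]]]] /P[Gh [a' [b' [le' Hh]]]].
  rewrite (shift_len_abs rr (shift_mul Hg Hh)) (shift_len_abs rr Hg) (shift_len_abs rr Hh).
  lia.
move=> S [SG SM Sadd] sub g Sg.
have gr := ray_aut g rr.
have [[a [b Hg]]|nt] := pselect (tails (g \o r) r).
  apply/P; split; first exact: SG.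
  exists a, b; split=> //; rewrite leqNgt; apply/negP => lt.
  have [c cc cr] := line_extending branch rr.
  have [h Gh Hh] := even_translation Ggrp G2 branch (a - b) cc.
  have Hr n : h (r (n + 0)) = r (n + 2 * (a - b)).
    by rewrite addn0 -cr /pos_ray Hh; congr c; lia.
  have Mh : fix_end_plus G (end_of r) h by apply/P; split=> //; exists 0, (2 * (a - b)).
  have := Sadd h g (sub _ Mh) Sg.
  rewrite (shift_len_abs rr (shift_mul Hr Hg)) (shift_len_abs rr Hr) (shift_len_abs rr Hg).
  lia.
exfalso; have [c [cc [a [b Hr]] [a' [b' Hg]]]] := line_between rr gr (fun t => nt (tails_sym t)).
(* At [c p] the action of [g] is known from [Hg]; the successor makes [p + q]
   positive. *)
pose p := b'.+1 + a; pose q := b.+1 + a'.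
have gp : g (c (Posz p)) = c (- Posz q)%R.
  have -> : c (Posz p) = r (b'.+1 + b) by rewrite -Hr.
  have -> : b'.+1 + b = b.+1 + b' by lia.
  by rewrite -[g _]/((g \o r) _) -Hg.
have [h Gh Hh] := even_translation Ggrp G2 branch (p + q) cc.
have Hr' n : h (r (n + b)) = r (n + (2 * (p + q) + b)).
  rewrite -Hr addnA -Hr /pos_ray Hh; congr c; lia.
have Mh : fix_end_plus G (end_of r) h.
  by apply/P; split=> //; exists b, (2 * (p + q) + b); split=> //; lia.
have := Sadd h g (sub _ Mh) Sg; have := translation_len_le (h * g)%g (c (Posz p)).
have [_ ->] := line_axial 0%R cc Hh.
by rewrite /= gp Hh cc /p /q; lia.
Qed.

Lemma additiveV (S : set (aut T)) : length_additive G S -> length_additive G [set g | S (g^-1)%g].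
Proof.
move=> [SG SM Sadd]; split.
- by move=> g /= /SG /GV; rewrite invgK.
- by move=> g h /= Sg Sh; rewrite invgM; exact: SM.
by move=> g h /= Sg Sh; rewrite -translation_lenV invgM Sadd // !translation_lenV addnC.
Qed.

(** Inversion exchanges the two semigroups of the end. *)
Lemma end_minus_maximal r : is_ray r -> maximal_additive (fix_end_minus G (end_of r)).
Proof.
move=> rr; have [add mx] := end_plus_maximal rr.
have E : fix_end_minus G (end_of r) = [set g | fix_end_plus G (end_of r) (g^-1)%g].
  by apply/seteqP; split=> g /(fix_end_minusV g _ Ggrp).
rewrite E; split; first exact: additiveV.
move=> S Sadd sub g Sg /=; apply: (mx _ (additiveV Sadd)); last by rewrite /= invgK.
by move=> h Ph; apply: sub; rewrite /= invgK.
Qed.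

Lemma standard_maximal (M : set (aut T)) : standard_semigroup R G M -> maximal_additive M.
Proof.
case=> [u v g Gg inv|v|v I Ip Ine|_ [r rr <-]|_ [r rr <-]].
- exact: midpoint_maximal inv.
- exact: vertex_maximal.
- by apply: vertex_semigroup_maximal => //; case: Ip.
- exact: end_plus_maximal.
exact: end_minus_maximal.
Qed.

End Maximality.

Theorem theorem4p11 (R : realType) (T : tree) (G : set (aut T))
    (Tfin : locally_finite T) (Tsemi : semi_homogeneous T)
    (Tval : forall v : T, (3 <= valency v)%N)
    (Ggrp : is_subgroup G) (Gclosed : closed G)
    (G2trans : two_transitive_on_ends G) :
  (forall S : set (aut T), s_multiplicative G S ->
     exists2 M, standard_semigroup R G M & S `<=` M) /\
  (forall M : set (aut T), standard_semigroup R G M ->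
     maximal_s_multiplicative G M).
Proof.
have branch := valency_branching Tfin Tval.
have sP S := s_multiplicativeP Tfin Tsemi Tval Ggrp Gclosed G2trans S.
split=> [S /sP|M /(standard_maximal Tfin branch Ggrp G2trans)[add mx]].
  exact: length_additive_contained.
split; first exact/sP.
by move=> S /sP addS sub; apply/seteqP; split=> //; exact: mx.
Qed.
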